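(* Let $T>0$ and $0<H<1$, let $\{B^H_t\}_{t}$ be a (real-valued) fractional Brownian motion with Hurst parameter $H$, and let $X_0$ be a real random variable with $\mathbb{E}[\|X_0\|^2]<\infty$, on a common probability space. Consider the equation $$\frac{\mathrm{d}X_t}{\mathrm{d}t}=-X_t+B^H_t,\quad 0\le t\le T,\qquad X_t|_{t=0}=X_0,$$ understood pathwise. For $N\in\mathbb{N}$ let $\Delta t_N=T/N$, $t_j=j\Delta t_N$, and let the Euler approximation be given by $X^N_0=X_0$ and $X^N_{t_j}=X^N_{t_{j-1}}+\Delta t_N\big(-X^N_{t_{j-1}}+B^H_{t_{j-1}}\big)$, $j=1,\ldots,N$. Then the Euler scheme for this initial value problem is of strong order $H+1/2$ for $0<H<1/2$, and of strong order $1$ for $1/2\le H<1$. More precisely, there are constants $c_1,c_2\ge 0$, independent of $N$, such that $$\max_{j=0,\ldots,N}\mathbb{E}\big[|X_{t_j}-X^N_{t_j}|\big]\le c_1\,\Delta t_N+c_2\,\Delta t_N^{H+1/2}\qquad\text{for all }N\in\mathbb{N}.$$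
   Context: The approximations are said to converge with strong order $\theta>0$ when there is a constant $C\ge 0$ such that $\max_{j=0,\ldots,N}\mathbb{E}[\|X_{t_j}-X_{t_j}^N\|]\le C\,\Delta t_N^\theta$ for all $N\in\mathbb{N}$. Fractional Brownian motion with Hurst parameter $H\in(0,1)$ is represented as $$B^H_t=\frac{1}{\Gamma(H+1/2)}\left(\int_{-\infty}^0\big((t-s)^{H-1/2}-(-s)^{H-1/2}\big)\,\mathrm{d}W_s+\int_0^t(t-s)^{H-1/2}\,\mathrm{d}W_s\right),$$ where $\{W_s\}$ is a two-sided Wiener process and $\Gamma$ is the Gamma function; $H=1/2$ is the Wiener process. Pathwise: for almost every $\omega$, $X_t(\omega)=X_0(\omega)+\int_0^t(-X_s(\omega)+B^H_s(\omega))\,\mathrm{d}s$ for $t\in[0,T]$. *)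

(* Defs.v *)
From HB Require Import structures.
From mathcomp Require Import all_boot all_order all_algebra.
From mathcomp Require Import all_classical all_reals all_analysis.

Set Implicit Arguments.
Unset Strict Implicit.
Unset Printing Implicit Defensive.

Import Order.TTheory GRing.Theory Num.Theory.
Import numFieldNormedType.Exports.

Local Open Scope classical_set_scope.
Local Open Scope ring_scope.

Definition gamma_fun (R : realType) (a : R) : R :=
  \int[@lebesgue_measure R]_(x in `]0, +oo[) (x `^ (a - 1) * expR (- x)).

Section wiener.
Context {d : measure_display} {Omega : measurableType d} {R : realType}.
Variable P : probability Omega R.

(* The product rule is only stated for the whole family: taking some of the
   [A i] to be [setT] gives it for every subfamily. *)
Definition mutually_independent (n : nat) (X : 'I_n -> Omega -> R) : Prop :=
  forall A : 'I_n -> set R, (forall i, measurable (A i)) ->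
    P (\bigcap_(i in [set: 'I_n]) (X i @^-1` A i)) =
    (\prod_(i < n) P (X i @^-1` A i))%E.

Definition increment (W : R -> {RV P >-> R}) (s t : R) (w : Omega) : R :=
  W t w - W s w.

(* [normal_prob m s] takes the standard deviation [s], not the variance. *)
Definition two_sided_wiener (W : R -> {RV P >-> R}) : Prop :=
  [/\ {ae P, forall w, W 0 w = 0},
      {ae P, forall w, continuous (fun t => W t w)},
      (forall s t, s < t -> forall A : set R, measurable A ->
         P (increment W s t @^-1` A) = normal_prob 0 (Num.sqrt (t - s)) A)
    & (forall (n : nat) (t : nat -> R), nondecreasing_seq t ->
         mutually_independent (fun i : 'I_n => increment W (t i) (t i.+1)))].

(* A list of triples [((a, u), v)] with [u <= v] represents the step function
   given by the sum of the [a * \1_(]u, v])]; the intervals may overlap. *)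
Definition steps_wf (s : seq (R * R * R)) : bool :=
  all (fun p => p.1.2 <= p.2) s.

Definition step_fun (s : seq (R * R * R)) (x : R) : R :=
  \sum_(p <- s) p.1.1 * \1_(`]p.1.2, p.2] : set R) x.

Definition step_integral (W : R -> {RV P >-> R}) (s : seq (R * R * R))
    (w : Omega) : R :=
  \sum_(p <- s) p.1.1 * increment W p.1.2 p.2 w.

(* [Y] is (a version of) the Wiener integral of the deterministic function [f]
   over [D]: [f \_ D], that is [f] extended by 0 outside [D], is
   square-integrable, and [Y] is the L^2(P)-limit of the integrals of step
   functions converging to [f \_ D] in L^2(R). *)
Definition is_wiener_integral (W : R -> {RV P >-> R}) (D : set R) (f : R -> R)
    (Y : {RV P >-> R}) : Prop :=
  let g := f \_ D in
  [/\ measurable_fun [set: R] g,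
      (\int[@lebesgue_measure R]_x (g x ^+ 2)%:E < +oo)%E
    & exists s : nat -> seq (R * R * R),
        [/\ (forall n, steps_wf (s n)),
            (fun n => \int[@lebesgue_measure R]_x
               ((g x - step_fun (s n) x) ^+ 2)%:E)%E @ \oo --> (0 : \bar R)%E
          & (fun n => 'E_P[fun w => ((Y w - step_integral W (s n) w) ^+ 2)%R])%E
              @ \oo --> (0 : \bar R)%E]].

(* The Mandelbrot--Van Ness representation, for times [t >= 0] only; it does
   not normalise the variance of [B 1] to 1. The singular
   endpoints of the kernels are Lebesgue-null, so the values of [`^] at 0 are
   irrelevant. *)
Definition fractional_brownian_motion (H : R) (B : R -> {RV P >-> R}) : Prop :=
  {ae P, forall w, {within `[0, +oo[, continuous (fun t => B t w)}} /\
  exists2 W : R -> {RV P >-> R}, two_sided_wiener W &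
    forall t, 0 <= t ->
      exists Y1 Y2 : {RV P >-> R},
        [/\ is_wiener_integral W `]-oo, 0]
              (fun s => (t - s) `^ (H - 1 / 2) - (- s) `^ (H - 1 / 2)) Y1,
            is_wiener_integral W `[0, t] (fun s => (t - s) `^ (H - 1 / 2)) Y2
          & {ae P, forall w,
              B t w = (gamma_fun (H + 1 / 2))^-1 * (Y1 w + Y2 w)}].

(* Integrability is part of the notion of solution, since [Rintegral] is a
   total function. *)
Definition pathwise_solution (T : R) (B : R -> {RV P >-> R})
    (X0 : {RV P >-> R}) (X : R -> {RV P >-> R}) : Prop :=
  {ae P, forall w, forall t, 0 <= t <= T ->
    (@lebesgue_measure R).-integrable `[0, t]
      (EFin \o (fun s => - X s w + B s w)) /\
    X t w = X0 w + \int[@lebesgue_measure R]_(s in `[0, t]) (- X s w + B s w)}.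

Definition time_step (T : R) (N : nat) : R := T / N%:R.

Definition grid (T : R) (N j : nat) : R := j%:R * time_step T N.

Fixpoint euler (T : R) (B : R -> {RV P >-> R}) (X0 : {RV P >-> R})
    (N j : nat) (w : Omega) : R :=
  if j is k.+1 then
    euler T B X0 N k w +
      time_step T N * (- euler T B X0 N k w + B (grid T N k) w)
  else X0 w.

Definition max_mean_error (T : R) (X : R -> {RV P >-> R})
    (XN : nat -> nat -> Omega -> R) (N : nat) : \bar R :=
  \big[maxe/-oo%E]_(j < N.+1)
    ('E_P[fun w => `|X (grid T N j) w - XN N j w|%R])%E.

Definition strong_order (T : R) (X : R -> {RV P >-> R})
    (XN : nat -> nat -> Omega -> R) (theta : R) : Prop :=
  0 < theta /\
  exists2 C : R, 0 <= C & forall N : nat, (0 < N)%N ->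
    (max_mean_error T X XN N <= (C * time_step T N `^ theta)%:E)%E.

End wiener.

(* Main.v *)
Require Import Defs.
From HB Require Import structures.
From mathcomp Require Import all_boot all_order all_algebra.
From mathcomp Require Import all_classical all_reals all_analysis.
From mathcomp Require Import measurable_realfun ring lra.

Import Order.TTheory GRing.Theory Num.Theory.
Import numFieldNormedType.Exports.

(** Subtract the Euler recursion from the integral equation, cell by cell. The
    error at [t_j] is bounded by three terms: [Delta] times the sum of the
    earlier errors, which a discrete Gronwall argument absorbs; the variation
    of [X] inside the cells, of order [Delta * (`|X0| + \int `|B|)] by a
    pathwise Gronwall bound ([solution_bound]); and the modulus of
    [S_j = \sum_(k < j) \int_(t_k)^(t_(k+1)) (B_s - B_(t_k)) ds]. The rate is
    decided by [S_j] ([path_error_le], [euler_mean_error]).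

    The second moment of [S_j] is a double sum of covariances of increments of
    [B], and these follow by polarization ([sqint_sum_increments]) from
    [E (B_t - B_s) ^+ 2 = c * `|t - s| `^ (2 * H)] alone. For [2 * H <= 1] the
    function [x `^ (2 * H)] is concave, so covariances between distinct
    cells are at most zero; only the diagonal counts, and
    [E S_j ^+ 2 <= C * Delta `^ (2 * H + 1)]. For [2 * H >= 1] it is convex and
    the covariances are bounded by second differences, whose sum telescopes to
    [O(Delta)] for each cell, whence [E S_j ^+ 2 <= C * Delta ^+ 2].

    The variance of [B_t - B_s] comes from the Wiener isometry
    ([wiener_limit_isometry]). For step functions it is again polarization, now
    applied both to the Wiener process and to [t |-> \1_(`]-oo, t])] under
    Lebesgue measure; it passes to [L^2] limits, and the scaling of the
    Mandelbrot--Van Ness kernel gives the power [2 * H] ([fbm_variance]).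
    Integrability of the kernel is part of the assumption that the Wiener
    integrals exist.

    All time integrals of random paths are handled as almost sure limits of
    Riemann sums, and Fatou's lemma ([mean_bound_limit]) transfers the moment
    bounds. Thus the noise enters every expectation through finitely many
    of the [B_t]. *)

Local Open Scope classical_set_scope.
Local Open Scope ring_scope.

(** * Mean squares and polarization *)

Section mean_square.
Context {d : measure_display} {T : measurableType d} {R : realType}.
Variable mu : {measure set T -> \bar R}.
Implicit Types f g : T -> R.

Definition sqint f : \bar R := (\int[mu]_x ((f x) ^+ 2)%:E)%E.

Lemma sqint_ge0 f : (0 <= sqint f)%E.
Proof. by apply: integral_ge0 => x _; rewrite lee_fin sqr_ge0. Qed.

Lemma eq_sqint f g : f =1 g -> sqint f = sqint g.
Proof. by move=> fg; apply: eq_integral => x _; rewrite fg. Qed.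

Lemma measurable_sqr_EFin f : measurable_fun setT f ->
  measurable_fun setT (fun x => ((f x) ^+ 2)%:E).
Proof. by move=> mf; apply/measurable_EFinP; exact: measurable_funX. Qed.

Lemma ae_eq_sqint f g : measurable_fun setT f -> measurable_fun setT g ->
  {ae mu, forall x, f x = g x} -> sqint f = sqint g.
Proof.
move=> mf mg fg; apply: ae_eq_integral => //; [exact: measurable_sqr_EFin..|].
by apply: filterS fg => x -> _.
Qed.

Lemma sqintZ (a : R) f : measurable_fun setT f ->
  sqint (fun x => a * f x) = ((a ^+ 2)%:E * sqint f)%E.
Proof.
move=> mf; rewrite /sqint -ge0_integralZl_EFin ?sqr_ge0//.
- by apply: eq_integral => x _; rewrite exprMn EFinM.
- by move=> x _; rewrite lee_fin sqr_ge0.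
- exact: measurable_sqr_EFin.
Qed.

(** Young's inequality with a free parameter serves as a triangle inequality
    that involves no square root of an extended real. *)
Lemma sqint_le (e : R) f g : 0 < e ->
  measurable_fun setT f -> measurable_fun setT g ->
  (sqint f <= (1 + e)%:E * sqint g +
              (1 + e^-1)%:E * sqint (fun x => (f x - g x)%R))%E.
Proof.
move=> e0 mf mg; have mfg := measurable_funB mf mg.
have sq0 : forall x : R, (0 <= (x ^+ 2)%:E :> \bar R)%E.
  by move=> x; rewrite lee_fin sqr_ge0.
have e1 : (0 <= 1 + e) by rewrite addr_ge0// ltW.
have e2 : (0 <= 1 + e^-1) by rewrite addr_ge0// invr_ge0 ltW.
rewrite /sqint -!ge0_integralZl_EFin//; [|exact: measurable_sqr_EFin..].
rewrite -ge0_integralD//; last first.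
- by apply: measurable_funeM; exact: measurable_sqr_EFin.
- by move=> x _; rewrite mule_ge0.
- by apply: measurable_funeM; exact: measurable_sqr_EFin.
- by move=> x _; rewrite mule_ge0.
apply: ge0_le_integral => //.
- exact: measurable_sqr_EFin.
- by apply: emeasurable_funD; apply: measurable_funeM; exact: measurable_sqr_EFin.
- move=> x _; rewrite -!EFinM -EFinD lee_fin.
  rewrite -subr_ge0.
  suff -> : (1 + e) * g x ^+ 2 + (1 + e^-1) * (f x - g x) ^+ 2 - f x ^+ 2 =
     e^-1 * (e * g x - (f x - g x)) ^+ 2.
    by rewrite mulr_ge0 ?sqr_ge0// invr_ge0 ltW.
  by field; rewrite gt_eqF.
Qed.

Lemma sqintD_lty f g : measurable_fun setT f -> measurable_fun setT g ->
  (sqint f < +oo -> sqint g < +oo -> sqint (fun x => (f x + g x)%R) < +oo)%E.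
Proof.
move=> mf mg f0 g0.
apply: le_lt_trans (sqint_le _ _ g ltr01 _ _) _ => //.
  exact: measurable_funD.
apply: lte_add_pinfty; rewrite lte_mul_pinfty ?lee_fin ?addr_ge0 ?invr_ge0//.
by rewrite (eq_sqint _ f) // => x; rewrite addrK.
Qed.

End mean_square.

Section mean_square_limit.
Context {d1 d2 : measure_display} {T1 : measurableType d1}
  {T2 : measurableType d2} {R : realType}.
Variables (mu : {measure set T1 -> \bar R}) (nu : {measure set T2 -> \bar R}).

(** An inequality between the mean squares of two approximating sequences, even
    on different measure spaces, survives in the [L^2] limits; used in both
    directions, it carries an isometry over to the limits. *)
Lemma sqint_limit_le (fn : nat -> T1 -> R) (f : T1 -> R)
    (hn : nat -> T2 -> R) (h : T2 -> R) :
  (forall n, measurable_fun setT (fn n)) -> measurable_fun setT f ->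
  (forall n, measurable_fun setT (hn n)) -> measurable_fun setT h ->
  (forall n, sqint mu (fn n) <= sqint nu (hn n))%E ->
  (fun n => sqint mu (fun x => f x - fn n x)) @ \oo --> 0%E ->
  (fun n => sqint nu (fun x => h x - hn n x)) @ \oo --> 0%E ->
  (sqint mu f <= sqint nu h)%E.
Proof.
move=> mfn mf mhn mh le_fh cf ch.
have [->|] := eqVneq (sqint nu h) +oo%E; first exact: leey.
rewrite -ltey => hoo; set A := sqint nu h.
have A0 : (0 <= A)%E := sqint_ge0 _ _.
have /fineK AE : A \is a fin_num by rewrite ge0_fin_numE.
have a0 : 0 <= fine A by rewrite fine_ge0.
apply/lee_addgt0Pr => eps eps0; rewrite -AE -EFinD.
(* [sqint_le] is applied twice with this [e <= 1], and [(1 + e) ^+ 2] is at most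
   [1 + 3 * e]: the loss on [A] is at most [eps / 2]. *)
pose e := Num.min 1 (eps / (6 * (fine A + 1))).
have e0 : 0 < e by rewrite lt_min ltr01 divr_gt0// mulr_gt0// ltr_wpDl.
have e1 : e <= 1 by rewrite ge_min lexx.
have eA : 6 * (e * fine A) <= eps.
  rewrite (@le_trans _ _ (6 * (eps / (6 * (fine A + 1)) * (fine A + 1))))//.
    rewrite ler_pM2l//; apply: ler_pM => //; first exact: ltW.
      by rewrite ge_min lexx orbT.
    by rewrite lerDl.
  rewrite le_eqVlt; apply/orP; left; apply/eqP; field.
  by rewrite gt_eqF// ltr_wpDl.
pose K := 2 * (1 + e^-1).
have K0 : 0 < K by rewrite mulr_gt0// addr_gt0// invr_gt0.
pose dl := eps / (4 * K).
have dl0 : 0 < dl by rewrite divr_gt0// mulr_gt0.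
have small (u : nat -> \bar R) : (forall n, 0 <= u n)%E -> u @ \oo --> 0%E ->
    \forall n \near \oo, (u n <= dl%:E)%E.
  move=> u0 cu; have [_ /cvgrPdist_le /(_ _ dl0) fc] := (fine_cvgP _ _).1 cu.
  have [fu _] := (fine_cvgP _ _).1 cu.
  near=> n; rewrite -[u n]fineK; last by near: n.
  rewrite lee_fin -(@ger0_norm _ (fine (u n))) ?fine_ge0//.
  rewrite -normrN -[- _]sub0r.
  by near: n.
have := small _ (fun=> sqint_ge0 _ _) cf.
have := small _ (fun=> sqint_ge0 _ _) ch.
move=> H1 H2.
near \oo => n.
have Hf := sqint_le mu e f (fn n) e0 mf (mfn n).
have Hh := sqint_le nu e (hn n) h e0 (mhn n) mh.
have e10 : 0 <= 1 + e by rewrite addr_ge0// ltW.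
have e20 : 0 <= 1 + e^-1 by rewrite addr_ge0// invr_ge0 ltW.
have Hh' : (sqint nu (hn n) <= ((1 + e) * fine A + (1 + e^-1) * dl)%:E)%E.
  apply: le_trans Hh _; rewrite [leRHS]EFinD !EFinM AE leeD2l//.
  apply: lee_wpmul2l; first by rewrite lee_fin.
  rewrite (_ : sqint nu _ = sqint nu (fun x => h x - hn n x)).
    by near: n.
  by apply: eq_integral => x _; rewrite -sqrrN opprB.
apply: le_trans Hf _.
have D1 : (sqint mu (fun x => (f x - fn n x)%R) <= dl%:E)%E by near: n.
apply: le_trans (leeD (lee_wpmul2l _ (le_trans (le_fh n) Hh'))
                      (lee_wpmul2l _ D1)) _; rewrite ?lee_fin//.
have dlK : K * dl = eps / 4.
  by rewrite /dl; field; rewrite gt_eqF.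
have Hd : (1 + e^-1) * dl = eps / 8.
  by move: dlK; rewrite /K; lra.
rewrite Hd.
have ee : e * (e * fine A) <= e * fine A.
  by rewrite ler_piMl// mulr_ge0// ltW.
have := ler_wpM2r (ltW eps0) e1.
nra.
Unshelve. all: by end_near.
Qed.

End mean_square_limit.

Section polarization.
Context {d : measure_display} {T : measurableType d} {R : realType}.
Variable mu : {measure set T -> \bar R}.
Context {I : Type}.
Variables (Z : I -> T -> R) (V : I -> I -> R).
Hypothesis mZ : forall i, measurable_fun setT (Z i).
Hypothesis ZV : forall i j, sqint mu (fun x => Z i x - Z j x) = (V i j)%:E.

Definition increment_product (p q : R * I * I) : R :=
  p.1.1 * q.1.1 * ((V p.2 q.1.2 + V p.1.2 q.2 - V p.2 q.2 - V p.1.2 q.1.2) / 2).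

Let sqZ i j := (fun x => ((Z i x - Z j x) ^+ 2)%:E).

Let int_sqZ i j : mu.-integrable setT (sqZ i j).
Proof.
apply/integrableP; split.
  by apply: measurable_sqr_EFin; exact: measurable_funB.
rewrite (_ : (\int[mu]_x `|sqZ i j x|)%E = (V i j)%:E) ?ltry// -ZV.
by apply: eq_integral => x _; rewrite gee0_abs// lee_fin sqr_ge0.
Qed.

Let prd (p q : R * I * I) x : \bar R :=
  ((p.1.1 * (Z p.2 x - Z p.1.2 x)) * (q.1.1 * (Z q.2 x - Z q.1.2 x)))%:E.

Let prdE p q : prd p q = (fun x => (p.1.1 * q.1.1 / 2)%:E *
  (((sqZ p.2 q.1.2 \+ sqZ p.1.2 q.2) \- sqZ p.2 q.2) \- sqZ p.1.2 q.1.2) x)%E.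
Proof.
apply/funext => x; rewrite /prd /sqZ /= -!EFinD -!EFinM; congr EFin.
by field.
Qed.

Let int_cmb i j k l :
  mu.-integrable setT (((sqZ i j \+ sqZ k l) \- sqZ i l) \- sqZ k j)%E.
Proof.
by apply: integrableB => //; apply: integrableB => //; exact: integrableD.
Qed.

Let int_prd p q : mu.-integrable setT (prd p q).
Proof. by rewrite prdE; exact: integrableZl. Qed.

Let prd_val p q : (\int[mu]_x prd p q x)%E = (increment_product p q)%:E.
Proof.
rewrite prdE integralZl//.
rewrite integralB//; last first.
  by apply: integrableB => //; exact: integrableD.
rewrite integralB//; last exact: integrableD.
rewrite integralD//.
rewrite ![(\int[mu]_x sqZ _ _ x)%E]ZV -!EFinD -EFinM; congr EFin.
by rewrite /increment_product; field.
Qed.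

(** The quadratic form is expanded by writing each product of increments as a
    combination of squared increments, so that the second moments of the
    increments alone determine that of every linear combination. *)
Lemma sqint_sum_increments (s : seq (R * I * I)) :
  sqint mu (fun x => \sum_(p <- s) p.1.1 * (Z p.2 x - Z p.1.2 x)) =
  (\sum_(p <- s) \sum_(q <- s) increment_product p q)%:E.
Proof.
rewrite /sqint.
transitivity (\int[mu]_x (\sum_(p <- s) \sum_(q <- s) prd p q x))%E.
  apply: eq_integral => x _.
  rewrite expr2 mulr_suml -sumEFin; apply: eq_bigr => p _.
  by rewrite mulr_sumr -sumEFin.
rewrite integral_sum//; last by move=> p; exact: integrable_sum.
rewrite -sumEFin; apply: eq_bigr => p _.
by rewrite integral_sum// -sumEFin; apply: eq_bigr => q _; exact: prd_val.
Qed.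

End polarization.

(** * Affine substitution and the second moment of the normal law *)

Section affine_substitution.
Context {R : realType}.
Local Notation mu := (@lebesgue_measure R).

(** An affine image of Lebesgue measure is determined by its values on
    half-open intervals. *)
Lemma ge0_integral_affine (a b : R) (f : R -> \bar R) : 0 < b ->
  measurable_fun [set: R] f -> (forall x, 0 <= f x)%E ->
  (\int[mu]_x f x = b%:E * \int[mu]_x f (a + b * x)%R)%E.
Proof.
move=> b0 mf f0.
pose phi : measurableTypeR R -> measurableTypeR R := fun x : R => a + b * x.
have mphi : measurable_fun [set: measurableTypeR R] phi.
  by apply: measurable_funD => //; exact: measurable_funM.
pose k := NngNum (ltW b0).
pose nu := measure_function_pushforward__canonical__measure_function_Measure
  mu mphi.
have eqm : forall A, measurable A -> mu A = mscale k nu A.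
  apply: (@lebesgue_measure_unique R (mscale k nu)) => // _ [[x y]] _ <-.
  transitivity (b%:E * mu (phi @^-1` `]x, y]))%E; last by [].
  have -> : phi @^-1` `]x, y] = `]((x - a) / b), ((y - a) / b)]%classic.
    apply/seteqP; split => z /=; rewrite !in_itv /= /phi.
      by rewrite ltr_pdivrMr// ler_pdivlMr// ltrBlDl lerBrDl mulrC.
    by rewrite ltr_pdivrMr// ler_pdivlMr// ltrBlDl lerBrDl mulrC.
  rewrite !lebesgue_measure_itv /= !lte_fin ltr_pM2r ?invr_gt0// ltrD2r.
  case: ifPn => _; last by rewrite mule0.
  by rewrite -!EFinD -EFinM; congr EFin; field; rewrite gt_eqF.
rewrite (eq_measure_integral (mscale k nu)); last first.
  by move=> A mA _; exact: eqm.
rewrite ge0_integral_mscale//; congr (_ * _)%E.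
by rewrite ge0_integral_pushforward//.
Qed.

Lemma sqint_affine (a b : R) (f : R -> R) : 0 < b ->
  measurable_fun [set: R] f ->
  sqint mu f = (b%:E * sqint mu (fun x : R => f (a + b * x)%R))%E.
Proof.
move=> b0 mf.
rewrite /sqint (ge0_integral_affine a b (fun x => ((f x) ^+ 2)%:E))//.
  exact: measurable_sqr_EFin.
by move=> x; rewrite lee_fin sqr_ge0.
Qed.

End affine_substitution.

Section normal_second_moment.
Context {R : realType}.
Local Notation mu := (@lebesgue_measure R).

(** [normal_pdf m s] agrees almost everywhere with the Radon--Nikodym derivative
    because both have the same integral over every measurable set. *)
Lemma ge0_integral_normal_prob (m s : R) (f : R -> \bar R) :
  measurable_fun [set: R] f -> (forall x, 0 <= f x)%E ->
  (\int[normal_prob m s]_x f x = \int[mu]_x (f x * (normal_pdf m s x)%:E))%E.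
Proof.
move=> mf f0; have dom := normal_prob_dominates m s.
rewrite -(Radon_Nikodym_SigmaFinite.change_of_variables dom f0 measurableT mf).
have irn := Radon_Nikodym_SigmaFinite.f_integrable dom.
have mpdf : measurable_fun [set: R] (fun x => (normal_pdf m s x)%:E).
  by apply/measurable_EFinP; exact: measurable_normal_pdf.
apply: ae_eq_integral => //.
- by apply: emeasurable_funM => //; exact: measurable_int irn.
- by apply: emeasurable_funM.
- apply: ae_eqe_mul2l => /=.
  apply: integral_ae_eq => //= E _ mE.
  by rewrite -(Radon_Nikodym_SigmaFinite.f_integral dom mE).
Qed.

(** The variance of a Wiener increment of unit length, kept as a symbolic
    constant: rates of convergence depend on its being finite and on how second
    moments scale with the standard deviation. *)
Definition std_normal_moment2 : \bar R := (\int[normal_prob 0 1]_x (x ^+ 2)%:E)%E.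

Lemma std_normal_moment2_lty : (std_normal_moment2 < +oo)%E.
Proof.
rewrite /std_normal_moment2 ge0_integral_normal_prob//; last 2 first.
  by apply: (measurable_sqr_EFin id); exact: measurable_id.
  by move=> x; rewrite lee_fin sqr_ge0.
(* [x ^+ 2 / 4 <= expR (x ^+ 2 / 4)] bounds the integrand by a multiple of the
   density with variance two. *)
pose s : R := Num.sqrt 2.
have s0 : s != 0 by rewrite gt_eqF// sqrtr_gt0.
have s2 : s ^+ 2 = 2 by rewrite sqr_sqrtr.
have p2 : 0 < normal_peak s by exact: normal_peak_gt0.
pose C : R := 4 * normal_peak 1 / normal_peak s.
have C0 : 0 <= C by rewrite !mulr_ge0// ?invr_ge0 ?normal_peak_ge0.
have := integral_normal_pdf 0 s.
move=> I1; apply: (@le_lt_trans _ _ (C%:E * \int[mu]_x (normal_pdf 0 s x)%:E)%E);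
  last by rewrite I1 mule1 ltry.
rewrite -ge0_integralZl_EFin; last 4 first.
- exact: measurableT.
- by move=> x _; rewrite lee_fin normal_pdf_ge0.
- by apply/measurable_EFinP; exact: measurable_normal_pdf.
- exact: C0.
apply: ge0_le_integral => //.
- by move=> x _; rewrite mule_ge0// lee_fin ?sqr_ge0 ?normal_pdf_ge0.
- apply: emeasurable_funM; first exact: (measurable_sqr_EFin id).
  by apply/measurable_EFinP; exact: measurable_normal_pdf.
- apply: measurable_funeM.
  by apply/measurable_EFinP; exact: measurable_normal_pdf.
move=> x _; rewrite -!EFinM lee_fin !normal_pdfE ?oner_eq0//.
rewrite /normal_fun s2 !subr0 expr1n.
have -> : C * (normal_peak s * expR (- x ^+ 2 / (2 *+ 2))) =
   normal_peak 1 * (4 * expR (- x ^+ 2 / (2 *+ 2))).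
  by rewrite /C; field; rewrite gt_eqF.
rewrite mulrCA ler_wpM2l ?normal_peak_ge0//.
have -> : - x ^+ 2 / (1 *+ 2) = - x ^+ 2 / (2 *+ 2) - x ^+ 2 / 4.
  by rewrite -[1 *+ 2]/(1 + 1) -[2 *+ 2]/(2 + 2); field.
rewrite expRD mulrCA -[leRHS]mulrC ler_wpM2l ?expR_ge0//.
rewrite expRN ler_pdivrMr ?expR_gt0//.
have := expR_ge1Dx (x ^+ 2 / 4).
lra.
Qed.

Lemma normal_prob_moment2 (s : R) : 0 < s ->
  (\int[normal_prob 0 s]_x (x ^+ 2)%:E = (s ^+ 2)%:E * std_normal_moment2)%E.
Proof.
move=> s0.
have msq : measurable_fun [set: R] (fun x : R => (x ^+ 2)%:E).
  exact: (measurable_sqr_EFin id).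
have sq0 (x : R) : (0 <= (x ^+ 2)%:E :> \bar R)%E by rewrite lee_fin sqr_ge0.
have mpdf u : measurable_fun [set: R] (fun x => (normal_pdf 0 u x)%:E).
  by apply/measurable_EFinP; exact: measurable_normal_pdf.
rewrite /std_normal_moment2; do 2 (rewrite ge0_integral_normal_prob;
  [|exact: msq|exact: sq0]).
rewrite (ge0_integral_affine 0 s); last 3 first.
- exact: s0.
- by apply: emeasurable_funM; [exact: msq|exact: mpdf].
- by move=> x; rewrite mule_ge0// lee_fin normal_pdf_ge0.
have mcomp : measurable_fun [set: R] (fun x => 0 + s * x).
  by apply: measurable_funD => //; exact: measurable_funM.
have m1 : measurable_fun [set: R] (fun x => (x ^+ 2)%:E * (normal_pdf 0 1 x)%:E)%E.
  by apply: emeasurable_funM; [exact: msq|exact: mpdf].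
have ms : measurable_fun [set: R] (fun x =>
    ((0 + s * x) ^+ 2)%:E * (normal_pdf 0 s (0 + s * x))%:E)%E.
  apply: emeasurable_funM; first exact: measurableT_comp msq mcomp.
  exact: measurableT_comp (mpdf s) mcomp.
rewrite -[RHS]ge0_integralZl_EFin; last 4 first.
- exact: measurableT.
- by move=> x _; rewrite mule_ge0// lee_fin normal_pdf_ge0.
- exact: m1.
- exact: sqr_ge0.
rewrite -[LHS]ge0_integralZl_EFin; last 4 first.
- exact: measurableT.
- by move=> x _; rewrite mule_ge0// lee_fin normal_pdf_ge0.
- exact: ms.
- exact: ltW.
apply: eq_integral => x _; rewrite add0r -!EFinM; congr EFin.
rewrite !normal_pdfE ?oner_eq0 ?gt_eqF// /normal_fun /normal_peak !subr0.
rewrite expr1n mul1r.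
have -> : Num.sqrt (s ^+ 2 * pi *+ 2) = s * Num.sqrt (pi *+ 2) :> R.
  by rewrite -mulrnAr sqrtrM ?sqr_ge0// sqrtr_sqr gtr0_norm.
have -> : - (s * x) ^+ 2 / (s ^+ 2 *+ 2) = - x ^+ 2 / (1 *+ 2).
  by field; rewrite gt_eqF.
have p0 : Num.sqrt (pi *+ 2) != 0 :> R.
  by rewrite gt_eqF// sqrtr_gt0 pmulrn_lgt0// pi_gt0.
by field; rewrite p0 gt_eqF.
Qed.

End normal_second_moment.

(** * The Wiener isometry *)

Section wiener_isometry.
Context {d : measure_display} {Omega : measurableType d} {R : realType}.
Variable P : probability Omega R.
Variable W : R -> {RV P >-> R}.
Hypothesis wW : two_sided_wiener W.
Local Notation mu := (@lebesgue_measure R).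

Definition increment_var : R := fine (@std_normal_moment2 R).

Lemma increment_varE : @std_normal_moment2 R = increment_var%:E.
Proof.
rewrite fineK// ge0_fin_numE ?std_normal_moment2_lty//.
by apply: integral_ge0 => x _; rewrite lee_fin sqr_ge0.
Qed.

Lemma increment_var_ge0 : 0 <= increment_var.
Proof.
by apply: fine_ge0; apply: integral_ge0 => x _; rewrite lee_fin sqr_ge0.
Qed.

Lemma sqint_wiener_increment (t s : R) :
  sqint P (fun w => W t w - W s w) = (increment_var * `|t - s|)%:E.
Proof.
wlog st : s t / s <= t => [wl|].
  have [st|/ltW ts] := leP s t; first exact: wl.
  rewrite distrC -wl//; apply: eq_integral => w _.
  by rewrite -sqrrN opprB.
move: st; rewrite le_eqVlt => /predU1P[<-|st].
  rewrite subrr normr0 mulr0 /sqint integral0_eq// => w _.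
  by rewrite subrr expr0n.
have [_ _ gauss _] := wW.
have msq : measurable_fun [set: R] (fun x : R => (x ^+ 2)%:E).
  exact: (measurable_sqr_EFin id).
have sq0 (x : R) : (0 <= (x ^+ 2)%:E :> \bar R)%E by rewrite lee_fin sqr_ge0.
pose X : Omega -> measurableTypeR R := fun w => W t w - W s w.
have mX : measurable_fun [set: Omega] X by exact: measurable_funB.
pose nu := measure_function_pushforward__canonical__measure_function_Measure
  P mX.
transitivity (\int[nu]_x (x ^+ 2)%:E)%E; first by rewrite ge0_integral_pushforward.
rewrite (eq_measure_integral (normal_prob 0 (Num.sqrt (t - s)))); last first.
  by move=> A mA _; exact: gauss.
rewrite normal_prob_moment2 ?sqrtr_gt0 ?subr_gt0// sqr_sqrtr ?subr_ge0 ?ltW//.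
by rewrite increment_varE -EFinM gtr0_norm ?subr_gt0// mulrC.
Qed.

Let Zleb (t x : R) : R := Num.sqrt increment_var * \1_(`]-oo, t] : set R) x.

Let mZleb t : measurable_fun [set: R] (Zleb t).
Proof. by apply: measurable_funM => //; exact: measurable_indic. Qed.

Let ZlebB (s t x : R) : s <= t ->
  Zleb t x - Zleb s x = Num.sqrt increment_var * \1_(`]s, t] : set R) x.
Proof.
move=> st; rewrite /Zleb -mulrBr; congr (_ * _).
rewrite !indicE !mem_setE !in_itv /=.
case: (ltP s x) => sx; first by rewrite subr0.
by rewrite (le_trans sx st) subrr.
Qed.

Let sqint_Zleb (t s : R) :
  sqint mu (fun x => Zleb t x - Zleb s x) = (increment_var * `|t - s|)%:E.
Proof.
wlog st : s t / s <= t => [wl|].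
  have [st|/ltW ts] := leP s t; first exact: wl.
  rewrite distrC -wl//; apply: eq_integral => w _.
  by rewrite -sqrrN opprB.
rewrite (_ : sqint mu _ = sqint mu (fun x =>
    Num.sqrt increment_var * \1_(`]s, t] : set R) x)); last first.
  by apply: eq_sqint => x; exact: ZlebB.
rewrite sqintZ; last exact: measurable_indic.
rewrite sqr_sqrtr ?increment_var_ge0// EFinM; congr (_ * _)%E.
rewrite /sqint.
under eq_integral do rewrite indicE expr2 -natrM mulnb andbb -indicE.
rewrite integral_indic//= setIT lebesgue_measure_itv /= lte_fin.
rewrite ger0_norm ?subr_ge0//.
by move: st; rewrite le_eqVlt => /predU1P[->|->//]; rewrite ltxx subrr.
Qed.

(** Both sides are the quadratic form of [sqint_sum_increments] for a process
    whose increments have variance proportional to their length: the Wiener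
    process on the one hand, and [t |-> \1_(`]-oo, t])] under Lebesgue measure
    on the other. *)
Lemma step_integral_isometry (s : seq (R * R * R)) : steps_wf s ->
  sqint P (step_integral W s) =
  sqint mu (fun x => Num.sqrt increment_var * step_fun s x).
Proof.
move=> ws; transitivity (sqint mu (fun x =>
    \sum_(p <- s) p.1.1 * (Zleb p.2 x - Zleb p.1.2 x))).
  rewrite /step_integral /increment.
  rewrite (sqint_sum_increments P (fun t => W t : _ -> _) _ _
             sqint_wiener_increment)//.
  by rewrite (sqint_sum_increments mu Zleb _ _ sqint_Zleb).
apply: eq_sqint => x; rewrite /step_fun mulr_sumr !big_seq.
apply: eq_bigr => p ps; rewrite ZlebB 1?mulrCA//.
by move/allP : ws => /(_ _ ps).
Qed.

Lemma measurable_step_fun (s : seq (R * R * R)) :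
  measurable_fun [set: R] (step_fun s).
Proof.
by apply: measurable_sum => p; apply: measurable_funM.
Qed.

Lemma measurable_step_integral (s : seq (R * R * R)) :
  measurable_fun [set: Omega] (step_integral W s).
Proof.
by apply: measurable_sum => p; apply: measurable_funM => //; exact: measurable_funB.
Qed.

(** The relation of an integrand on the whole line to its Wiener integral, for
    arbitrary functions [Y] so that it is stable under linear combinations. *)
Definition wiener_limit (g : R -> R) (Y : Omega -> R) : Prop :=
  [/\ measurable_fun [set: R] g, measurable_fun [set: Omega] Y &
  exists s : nat -> seq (R * R * R), [/\ (forall n, steps_wf (s n)),
    (fun n => sqint mu (fun x => g x - step_fun (s n) x)) @ \oo --> 0%E &
    (fun n => sqint P (fun w => Y w - step_integral W (s n) w)) @ \oo --> 0%E]].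

Lemma is_wiener_integral_limit (D : set R) (f : R -> R) (Y : {RV P >-> R}) :
  is_wiener_integral W D f Y -> wiener_limit (f \_ D) Y.
Proof.
move=> [mg _ [s [ws c1 c2]]]; split => //; exists s; split => //.
by move: c2; rewrite unlock.
Qed.

Lemma sqint_add_cvg0 {d' : measure_display} {T : measurableType d'}
    (nu : {measure set T -> \bar R}) (u v : nat -> T -> R) :
  (forall n, measurable_fun setT (u n)) ->
  (forall n, measurable_fun setT (v n)) ->
  (fun n => sqint nu (u n)) @ \oo --> 0%E ->
  (fun n => sqint nu (v n)) @ \oo --> 0%E ->
  (fun n => sqint nu (fun x => u n x + v n x)) @ \oo --> 0%E.
Proof.
move=> mu_ mv cu cv.
apply: (@squeeze_cvge _ _ _ _ (cst 0%E) _
  (fun n => 2%:E * sqint nu (u n) + 2%:E * sqint nu (v n))%E).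
- apply: nearW => n; rewrite sqint_ge0/=.
  apply: le_trans (sqint_le nu 1 _ (u n) ltr01 _ _) _ => //.
    exact: measurable_funD.
  rewrite invr1 -[1 + 1]/(2 : R) leeD2l//.
  rewrite (eq_sqint _ _ (v n))// => x.
  by rewrite addrAC subrr add0r.
- exact: cvg_cst.
- rewrite -[X in _ --> X](_ : (2%:E * 0 + 2%:E * 0)%E = 0%E); last first.
    by rewrite mule0 adde0.
  apply: cvgeD; [by rewrite mule0| |]; exact: cvgeZl.
Qed.

(** Concatenating two lists of steps adds the step functions and the step
    integrals alike, overlaps included. *)
Lemma wiener_limitD g1 g2 Y1 Y2 : wiener_limit g1 Y1 -> wiener_limit g2 Y2 ->
  wiener_limit (fun x => g1 x + g2 x) (fun w => Y1 w + Y2 w).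
Proof.
move=> [mg1 mY1 [s1 [ws1 cg1 cY1]]] [mg2 mY2 [s2 [ws2 cg2 cY2]]].
split; [exact: measurable_funD..|].
exists (fun n => s1 n ++ s2 n); split.
- by move=> n; rewrite /steps_wf all_cat; apply/andP; split; [exact: ws1|exact: ws2].
- rewrite (_ : (fun n => _) = (fun n => sqint mu (fun x =>
    (g1 x - step_fun (s1 n) x) + (g2 x - step_fun (s2 n) x)))).
    by apply: sqint_add_cvg0 => // n; apply: measurable_funB => //;
      exact: measurable_step_fun.
  apply/funext => n; apply: eq_sqint => x.
  by rewrite /step_fun big_cat/= opprD addrACA.
- rewrite (_ : (fun n => _) = (fun n => sqint P (fun w =>
    (Y1 w - step_integral W (s1 n) w) + (Y2 w - step_integral W (s2 n) w)))).
    by apply: sqint_add_cvg0 => // n; apply: measurable_funB => //;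
      exact: measurable_step_integral.
  apply/funext => n; apply: eq_sqint => w.
  by rewrite /step_integral big_cat/= opprD addrACA.
Qed.

Lemma wiener_limitZ (a : R) g Y : wiener_limit g Y ->
  wiener_limit (fun x => a * g x) (fun w => a * Y w).
Proof.
move=> [mg mY [s [ws cg cY]]]; split; [exact: measurable_funM..|].
exists (fun n => [seq (a * p.1.1, p.1.2, p.2) | p <- s n]).
have cvgZ0 (u : nat -> \bar R) : u @ \oo --> 0%E ->
    (fun n => (a ^+ 2)%:E * u n)%E @ \oo --> 0%E.
  by move=> cu; rewrite -[X in _ --> X](mule0 (a ^+ 2)%:E); exact: cvgeZl.
split.
- by move=> n; rewrite /steps_wf all_map; exact: ws.
- rewrite (_ : (fun n => _) = (fun n => (a ^+ 2)%:E * sqint mu (fun x =>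
    (g x - step_fun (s n) x)%R))%E); first exact: cvgZ0.
  apply/funext => n; rewrite -sqintZ; last first.
    by apply: measurable_funB => //; exact: measurable_step_fun.
  apply: eq_sqint => x; rewrite /step_fun big_map mulrBr mulr_sumr.
  by congr (_ - _); apply: eq_bigr => p _; rewrite mulrA.
- rewrite (_ : (fun n => _) = (fun n => (a ^+ 2)%:E * sqint P (fun w =>
    (Y w - step_integral W (s n) w)%R))%E); first exact: cvgZ0.
  apply/funext => n; rewrite -sqintZ; last first.
    by apply: measurable_funB => //; exact: measurable_step_integral.
  apply: eq_sqint => x; rewrite /step_integral big_map mulrBr mulr_sumr.
  by congr (_ - _); apply: eq_bigr => p _; rewrite mulrA.
Qed.

Lemma wiener_limit_isometry g Y : wiener_limit g Y ->
  sqint P Y = (increment_var%:E * sqint mu g)%E.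
Proof.
move=> [mg mY [s [ws cg cY]]].
rewrite -(sqr_sqrtr increment_var_ge0) -sqintZ//.
set r := Num.sqrt _.
have cgr : (fun n => sqint mu (fun x => r * g x - r * step_fun (s n) x))
    @ \oo --> 0%E.
  rewrite (_ : (fun n => _) = (fun n => (r ^+ 2)%:E * sqint mu (fun x =>
    (g x - step_fun (s n) x)%R))%E).
    by rewrite -[X in _ --> X](mule0 (r ^+ 2)%:E); exact: cvgeZl.
  apply/funext => n; rewrite -sqintZ.
    by apply: eq_sqint => x; rewrite mulrBr.
  by apply: measurable_funB => //; exact: measurable_step_fun.
have mr : measurable_fun [set: R] (fun x => r * g x) by exact: measurable_funM.
have mrs n : measurable_fun [set: R] (fun x => r * step_fun (s n) x).
  by apply: measurable_funM => //; exact: measurable_step_fun.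
apply/eqP; rewrite eq_le; apply/andP; split.
  apply: (sqint_limit_le P mu (fun n => step_integral W (s n)) Y
            (fun n x => r * step_fun (s n) x)) => //.
    by move=> n; exact: measurable_step_integral.
  by move=> n; rewrite step_integral_isometry.
apply: (sqint_limit_le mu P (fun n x => r * step_fun (s n) x) _
            (fun n => step_integral W (s n))) => //.
  by move=> n; exact: measurable_step_integral.
by move=> n; rewrite step_integral_isometry.
Qed.

End wiener_isometry.

(** * Variance of the increments of fractional Brownian motion *)

Section fbm_increments.
Context {R : realType}.
Local Notation mu := (@lebesgue_measure R).
Variable H : R.

Definition fbm_kernel (x : R) : R :=
  if 0 < x then x `^ (H - 1 / 2) else 0.

Lemma measurable_fbm_kernel : measurable_fun [set: R] fbm_kernel.
Proof.
apply: measurable_fun_ifT => //.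
exact: measurable_fun_ltr.
Qed.

Let mk (a b : R) : measurable_fun [set: R] (fun r => fbm_kernel (a + b * r)).
Proof.
apply: measurableT_comp; first exact: measurable_fbm_kernel.
by apply: measurable_funD => //; exact: measurable_funM.
Qed.

Lemma measurable_fbm_kernelB (a : R) :
  measurable_fun [set: R] (fun r => fbm_kernel (a - r)).
Proof.
rewrite (_ : (fun r => _) = (fun r => fbm_kernel (a + (-1) * r))) ?mk//.
by apply/funext => r; rewrite mulN1r.
Qed.

Lemma fbm_kernelM (b x : R) : 0 < b ->
  fbm_kernel (b * x) = b `^ (H - 1 / 2) * fbm_kernel x.
Proof.
move=> b0; rewrite /fbm_kernel pmulr_rgt0//; case: ifPn => x0; last by rewrite mulr0.
by rewrite powRM// ltW.
Qed.

(** Mean square of the kernel of [B 1 - B 0]; extended-real valued, because its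
    finiteness is read off the existence of the Wiener integrals only later. *)
Definition fbm_const : \bar R :=
  sqint mu (fun z => fbm_kernel (1 - z) - fbm_kernel (- z)).

(** The substitution [r = s + (t - s) * z] and the homogeneity of the kernel give
    the factor [(t - s) * (t - s) `^ (2 * (H - 1 / 2))]. *)
Lemma sqint_fbm_kernel_lt (s t : R) : s < t ->
  sqint mu (fun r => fbm_kernel (t - r) - fbm_kernel (s - r)) =
  ((`|t - s| `^ (2 * H))%:E * fbm_const)%E.
Proof.
move=> st; have ts0 : 0 < t - s by rewrite subr_gt0.
rewrite (sqint_affine s (t - s) _ ts0); last first.
  by apply: measurable_funB; exact: measurable_fbm_kernelB.
rewrite (_ : sqint mu _ = sqint mu (fun z => (t - s) `^ (H - 1 / 2) *
    (fbm_kernel (1 - z) - fbm_kernel (- z)))); last first.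
  apply: eq_sqint => z; rewrite mulrBr -!fbm_kernelM//.
  by congr (fbm_kernel _ - fbm_kernel _); ring.
have mN : measurable_fun [set: R] (fun z => fbm_kernel (1 - z) - fbm_kernel (- z)).
  apply: measurable_funB; first exact: measurable_fbm_kernelB.
  rewrite (_ : (fun r => _) = (fun r => fbm_kernel (0 - r))).
    exact: measurable_fbm_kernelB.
  by apply/funext => r; rewrite sub0r.
rewrite sqintZ// muleA -EFinM; congr (_%:E * _)%E.
rewrite gtr0_norm// -[X in X * _](@powRr1 _ (t - s)) ?ltW// -powR_mulrn ?powR_ge0//.
rewrite -powRrM -powRD; last by rewrite (gt_eqF ts0) implybT.
by congr powR; field.
Qed.

Hypothesis H_gt0 : 0 < H.

Lemma sqint_fbm_kernel (s t : R) : fbm_const \is a fin_num ->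
  sqint mu (fun r => fbm_kernel (t - r) - fbm_kernel (s - r)) =
  ((fine fbm_const * `|t - s| `^ (2 * H))%:E)%E.
Proof.
move=> /fineK cE; rewrite EFinM cE muleC.
have [st|ts|->] := ltgtP s t; first exact: sqint_fbm_kernel_lt.
  rewrite distrC -(sqint_fbm_kernel_lt _ _ ts); apply: eq_integral => r _.
  by rewrite -sqrrN opprB.
rewrite subrr normr0 powR0 ?mul0e; last by rewrite mulf_neq0// gt_eqF.
by rewrite /sqint integral0_eq// => r _; rewrite subrr expr0n.
Qed.

(** Equality may fail at [r = 0], where the two domains overlap, and at [r = t],
    where a zero exponent makes the power equal to one. *)
Lemma fbm_kernel_split (t : R) : 0 <= t ->
  {ae mu, forall r,
    ((fun s => (t - s) `^ (H - 1 / 2) - (- s) `^ (H - 1 / 2)) \_ `]-oo, 0]) r +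
    ((fun s => (t - s) `^ (H - 1 / 2)) \_ `[0, t]) r =
    fbm_kernel (t - r) - fbm_kernel (0 - r)}.
Proof.
move=> t0; exists ([set 0] `|` [set t]); split.
- exact: measurableU.
- by rewrite measureU0//; exact: lebesgue_measure_set1.
- move=> r /= rE; apply: contrapT => /not_orP[r0 rt]; apply: rE.
  rewrite !patchE !mem_setE !in_itv /= /fbm_kernel sub0r !subr_gt0 oppr_gt0.
  have [r_lt|r_gt|//] := ltgtP r 0.
    by rewrite (lt_le_trans r_lt t0) addr0.
  have [rt'|rt'|//] := ltgtP r t; first by rewrite add0r subr0.
  by rewrite addr0 subr0.
Qed.

End fbm_increments.

Section fbm_variance.
Context {d : measure_display} {Omega : measurableType d} {R : realType}.
Variables (P : probability Omega R) (H : R) (B : R -> {RV P >-> R}).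
Hypotheses (H_gt0 : 0 < H) (fbmB : fractional_brownian_motion H B).
Local Notation mu := (@lebesgue_measure R).

Let gam := (@gamma_fun R (H + 1 / 2))^-1.

Let fbm_limit : exists2 W : R -> {RV P >-> R}, two_sided_wiener W &
  forall t, 0 <= t -> exists g Y, [/\ wiener_limit P W g Y,
    {ae P, forall w, B t w = Y w},
    {ae mu, forall r, g r = gam * (fbm_kernel H (t - r) - fbm_kernel H (0 - r))} &
    ((sqint mu (fun r => (fbm_kernel H (t - r) - fbm_kernel H (0 - r))%R)) < +oo)%E].
Proof.
have [_ [W wW BW]] := fbmB; exists W => // t t0.
have [Y1 [Y2 [I1 I2 BE]]] := BW t t0.
have L1 := is_wiener_integral_limit P W _ _ _ I1.
have L2 := is_wiener_integral_limit P W _ _ _ I2.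
eexists; eexists; split.
- exact: (wiener_limitZ P W gam _ _ (wiener_limitD P W _ _ _ _ L1 L2)).
- exact: BE.
- apply: filterS (fbm_kernel_split H t t0) => [|r ->//].
  exact: (ae_filter_ringOfSetsType mu).
- have [[mg1 _ _] [mg2 _ _]] := (L1, L2).
  rewrite -(ae_eq_sqint mu _ _ _ _ (fbm_kernel_split H t t0)).
  + by apply: sqintD_lty => //; [case: I1|case: I2].
  + exact: measurable_funD.
  + by apply: measurable_funB; exact: measurable_fbm_kernelB.
Qed.

(** By the isometry the increment has, up to a constant, the mean square of the
    difference of two kernels, in which the terms at time zero cancel; [B t]
    itself has the kernel of an increment from time zero. *)
Lemma fbm_variance : exists2 c : R, 0 <= c &
  forall s t, 0 <= s -> 0 <= t ->
    sqint P (fun w => B t w - B s w) = (c * `|t - s| `^ (2 * H))%:E /\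
    sqint P (B t) = (c * `|t| `^ (2 * H))%:E.
Proof.
have [W wW L] := fbm_limit.
have cfin : fbm_const H \is a fin_num.
  have [_ [_ [_ _ _ fin]]] := L 1 ler01.
  rewrite ge0_fin_numE; last exact: sqint_ge0.
  suff -> : fbm_const H =
      sqint mu (fun r => fbm_kernel H (1 - r) - fbm_kernel H (0 - r)) by exact: fin.
  by apply: eq_sqint => r; rewrite sub0r.
have mk (a : R) : measurable_fun [set: R] (fun r => fbm_kernel H (a - r)).
  exact: measurable_fbm_kernelB.
have mkB (a b : R) :
    measurable_fun [set: R] (fun r => fbm_kernel H (a - r) - fbm_kernel H (b - r)).
  by apply: measurable_funB.
pose v := @increment_var R; pose c := v * (gam ^+ 2 * fine (fbm_const H)).
have c0 : 0 <= c.
  apply: mulr_ge0; first exact: increment_var_ge0.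
  apply: mulr_ge0; [exact: sqr_ge0|apply: fine_ge0; exact: sqint_ge0].
have key g Y (Z : Omega -> R) (s t : R) : wiener_limit P W g Y ->
    measurable_fun [set: Omega] Z ->
    {ae P, forall w, Z w = Y w} ->
    {ae mu, forall r, g r = gam * (fbm_kernel H (t - r) - fbm_kernel H (s - r))} ->
    sqint P Z = (c * `|t - s| `^ (2 * H))%:E.
  move=> Lg mZ ZY gE; have [mg mY _] := Lg.
  rewrite (ae_eq_sqint P _ _ mZ mY ZY) (wiener_limit_isometry P W wW _ _ Lg).
  rewrite (ae_eq_sqint mu _ _ mg _ gE); last first.
    by apply: measurable_funM => //; exact: mkB.
  rewrite sqintZ; last exact: mkB.
  transitivity (increment_var%:E * ((gam ^+ 2)%:E *
      (fine (fbm_const H) * `|t - s| `^ (2 * H))%:E))%E.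
    by congr (_ * (_ * _))%E; exact: sqint_fbm_kernel.
  rewrite -!EFinM; congr EFin.
  by rewrite /c /v !mulrA.
exists c => // s t s0 t0.
have [g1 [Y1 [L1 B1 k1 _]]] := L t t0.
have [g2 [Y2 [L2 B2 k2 _]]] := L s s0.
split; last by rewrite -[t in `|t|]subr0; exact: (key g1 Y1).
apply: (key (fun r => g1 r + -1 * g2 r) (fun w => Y1 w + -1 * Y2 w)).
- by apply: wiener_limitD => //; exact: wiener_limitZ.
- exact: measurable_funB.
- by apply: filterS2 B1 B2 => w -> ->; rewrite mulN1r.
- apply: filterS2 k1 k2 => [|r -> ->]; last by ring.
  exact: (ae_filter_ringOfSetsType mu).
Qed.

End fbm_variance.

(** * Covariances of increments *)

Section convex_increments.
Context {R : realType}.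

Definition convex_ge0 (f : R -> R) : Prop := forall (l x y : R),
  0 <= l <= 1 -> 0 <= x -> 0 <= y ->
  f (l * x + (1 - l) * y) <= l * f x + (1 - l) * f y.

(** Both [u + x] and [v] are barycenters of [u] and [v + x], with exchanged
    weights. *)
Lemma convex_increment (f : R -> R) (u v x : R) : convex_ge0 f ->
  0 <= u -> u <= v -> 0 <= x -> f (u + x) - f u <= f (v + x) - f v.
Proof.
move=> cf u0 uv x0; have [E0|w0] := eqVneq (v + x - u) 0.
  have -> : x = 0 by lra.
  by rewrite !addr0 !subrr.
have wp : 0 < v + x - u by rewrite lt_neqAle eq_sym w0/=; lra.
pose l := x / (v + x - u).
have l01 : 0 <= l <= 1.
  by rewrite divr_ge0 ?(ltW wp)//= ler_pdivrMr// mul1r; lra.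
have l01' : 0 <= 1 - l <= 1 by lra.
have lE : l * (v + x - u) = x by rewrite divfK.
have vx0 : 0 <= v + x by lra.
have := cf _ _ _ l01 vx0 u0.
have := cf _ _ _ l01' vx0 u0.
have -> : l * (v + x) + (1 - l) * u = u + x by lra.
have -> : (1 - l) * (v + x) + (1 - (1 - l)) * u = v by lra.
lra.
Qed.

Lemma powR_convex (a : R) : 1 <= a -> convex_ge0 (fun x => x `^ a).
Proof.
move=> a1 l x y /andP[l0 l1] x0 y0.
have := convex_powR a1 (Itv01 l0 l1) (x := x) (y := y).
by rewrite !inE /= !in_itv /= !andbT x0 y0 !convRE /= => /(_ isT isT).
Qed.

(** The inverse function, the power [a^-1], is convex and increasing. *)
Lemma powR_concave (a : R) : 0 < a -> a <= 1 -> convex_ge0 (fun x => - x `^ a).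
Proof.
move=> a0 a1 l x y l01 x0 y0; have [l0 l1] := andP l01.
have l2 : 0 <= 1 - l by lra.
rewrite !mulrN -opprD lerN2.
have ia1 : 1 <= a^-1 by rewrite invf_ge1.
have := powR_convex _ ia1 _ _ _ l01 (powR_ge0 x a) (powR_ge0 y a).
rewrite -!powRrM !divff ?gt_eqF// !powRr1// => h.
have X0 : 0 <= l * x `^ a + (1 - l) * y `^ a.
  by rewrite addr_ge0// mulr_ge0// powR_ge0.
have := ge0_ler_powR (ltW a0) _ _ h.
rewrite !nnegrE powR_ge0 addr_ge0 ?mulr_ge0// => /(_ isT isT).
by rewrite -powRrM mulVf ?gt_eqF// powRr1.
Qed.

End convex_increments.

Section increment_covariance.
Context {R : realType}.
Variable a : R.
Hypothesis a_gt0 : 0 < a.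

(** Covariance, up to a constant, of the increments of a process with
    [E (B t - B s) ^+ 2 = `|t - s| `^ a] over [[0, y]] and [[D, D + x]]. *)
Definition incr_cov (x y D : R) : R :=
  (`|D + x| `^ a + `|D - y| `^ a - `|D + x - y| `^ a - `|D| `^ a) / 2.

Definition powR_incr (L D : R) : R := (D + L) `^ a - D `^ a.

Lemma incr_covC x y D : incr_cov x y (- D) = incr_cov y x D.
Proof.
rewrite /incr_cov normrN.
have -> : `|- D + x| = `|D - x| by rewrite -normrN opprD opprK.
have -> : `|- D - y| = `|D + y| by rewrite -opprD normrN.
have -> : `|- D + x - y| = `|D + y - x|.
  by rewrite -normrN; congr `|_|; ring.
by rewrite (addrC (`|D - x| `^ a)).
Qed.

Lemma incr_cov_diag x y L : 0 <= x <= L -> 0 <= y <= L ->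
  incr_cov x y 0 <= L `^ a.
Proof.
move=> /andP[x0 xL] /andP[y0 yL]; rewrite /incr_cov !add0r normr0 normrN.
rewrite powR0 ?gt_eqF// subr0 (ger0_norm x0) (ger0_norm y0).
have L0 := le_trans x0 xL.
have h1 := ge0_ler_powR (ltW a_gt0) x0 L0 xL.
have h2 := ge0_ler_powR (ltW a_gt0) y0 L0 yL.
have := powR_ge0 `|x - y| a.
rewrite /= in h1 h2; lra.
Qed.

(** The covariance is half a difference of increments, of length [x], of the
    power function at [D] and [D - y]. *)
Lemma incr_cov_le0 x y L D : a <= 1 -> 0 <= x <= L -> 0 <= y <= L -> L <= D ->
  incr_cov x y D <= 0.
Proof.
move=> a1 /andP[x0 xL] /andP[y0 yL] LD.
have Dy : 0 <= D - y by lra.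
have Dyy : D - y <= D by lra.
have := convex_increment _ _ _ _ (powR_concave a a_gt0 a1) Dy Dyy x0.
rewrite /incr_cov !ger0_norm; try lra.
have -> : D + x - y = D - y + x by lra.
lra.
Qed.

(** Enlarging [y] and then [x] to [L] turns the covariance into a second
    difference, which telescopes when [D] runs through the multiples of [L]. *)
Lemma incr_cov_le x y L D : 1 <= a -> 0 <= x <= L -> 0 <= y <= L -> L <= D ->
  incr_cov x y D <= (powR_incr L D - powR_incr L (D - L)) / 2.
Proof.
move=> a1 /andP[x0 xL] /andP[y0 yL] LD; have cv := powR_convex a a1.
have I1 : (D - L + x) `^ a - (D - L) `^ a <= (D - y + x) `^ a - (D - y) `^ a.
  by apply: (convex_increment _ _ _ _ cv); lra.
have I2 : (D - L + x + L) `^ a - (D - L + x) `^ a <=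
    (D + L) `^ a - D `^ a by apply: (convex_increment _ _ _ _ cv); lra.
rewrite /incr_cov /powR_incr !ger0_norm; try lra.
have -> : D + x - y = D - y + x by lra.
have -> : D - L + L = D by lra.
have : D - L + x + L = D + x by lra.
move=> E; rewrite E in I2; lra.
Qed.

Lemma powR_incr_ge0 L D : 0 <= D -> 0 <= L -> 0 <= powR_incr L D.
Proof.
move=> D0 L0; rewrite subr_ge0.
by apply: (ge0_ler_powR (ltW a_gt0)); rewrite ?nnegrE; lra.
Qed.

(** The increment is largest at [D = T], and there it is at most the increment
    of the chord from [T] to [2 * T]. *)
Lemma powR_incr_le L D T : 1 <= a -> 0 <= D <= T -> 0 < T -> 0 <= L <= T ->
  powR_incr L D <= L / T * (2 * T) `^ a.
Proof.
move=> a1 /andP[D0 DT] T0 /andP[L0 LT]; have cv := powR_convex a a1.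
have h1 : (D + L) `^ a - D `^ a <= (T + L) `^ a - T `^ a.
  by apply: (convex_increment _ _ _ _ cv); lra.
apply: le_trans h1 _.
have l01 : 0 <= L / T <= 1.
  by rewrite divr_ge0 ?(ltW T0)//= ler_pdivrMr// mul1r.
have T2 : 0 <= 2 * T by lra.
have := cv _ _ _ l01 T2 (ltW T0).
have -> : L / T * (2 * T) + (1 - L / T) * T = T + L by field; rewrite gt_eqF.
have := mulr_ge0 (andP l01).1 (powR_ge0 T a).
lra.
Qed.

End increment_covariance.

(** * Second moment of the frozen Riemann sums *)

Section riemann_second_moment.
Context {d : measure_display} {T : measurableType d} {R : realType}.
Variable mu : {measure set T -> \bar R}.
Variables (B : R -> T -> R) (a c : R).
Hypothesis a_gt0 : 0 < a.
Hypothesis c_ge0 : 0 <= c.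
Hypothesis mB : forall t, measurable_fun [set: T] (B t).
Hypothesis varB : forall s t, 0 <= s -> 0 <= t ->
  sqint mu (fun w => B t w - B s w) = (c * `|t - s| `^ a)%:E.

(** Riemann sum, with [n] nodes in each of [j] cells of length [L], for the
    integral of the difference between [b] and [b] frozen at the left end of
    the cell. *)
Definition frozen_riemann (b : R -> R) (L : R) (n j : nat) : R :=
  \sum_(0 <= k < j) \sum_(0 <= i < n)
    L / n%:R * (b (k%:R * L + i%:R * (L / n%:R)) - b (k%:R * L)).

(** The nodes are indexed by (cell, position) pairs and the sum is a combination
    of increments from the left end of a cell, so that polarization applies;
    [g] bounds the covariances uniformly over the positions. *)
Lemma sqint_frozen_riemann_le (L : R) (n j : nat) (g : nat -> nat -> R) :
  0 <= L -> (0 < n)%N ->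
  (forall k l x y, (k < j)%N -> (l < j)%N -> 0 <= x <= L -> 0 <= y <= L ->
    incr_cov a x y (k%:R * L - l%:R * L) <= g k l) ->
  (sqint mu (fun w => frozen_riemann (B ^~ w) L n j) <=
    (c * (L ^+ 2 * \sum_(0 <= k < j) \sum_(0 <= l < j) g k l))%:E)%E.
Proof.
move=> L0 n0 cov_le; pose h := L / n%:R.
have h0 : 0 <= h by rewrite divr_ge0.
have nh : n%:R * h = L by rewrite mulrC divfK// pnatr_eq0 -lt0n.
pose tau (p : nat * nat) : R := p.1%:R * L + p.2%:R * h.
have tau0 p : 0 <= tau p by rewrite addr_ge0// mulr_ge0.
pose V p q := c * `|tau p - tau q| `^ a.
have VE p q : sqint mu (fun w => B (tau p) w - B (tau q) w) = (V p q)%:E.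
  exact: varB.
pose s := [seq (h, (k, 0), (k, i)) | k <- index_iota 0 j, i <- index_iota 0 n]%N.
rewrite (_ : sqint mu _ = sqint mu (fun w =>
    \sum_(p <- s) p.1.1 * (B (tau p.2) w - B (tau p.1.2) w))); last first.
  apply: eq_sqint => w; rewrite /s /frozen_riemann big_allpairs_dep /=.
  apply: eq_bigr => k _; apply: eq_bigr => i _.
  by rewrite /tau /= mul0r addr0.
rewrite (sqint_sum_increments mu (fun p => B (tau p)) V _ VE)//.
rewrite lee_fin /s big_allpairs_dep /=.
under eq_bigr => k _ do under eq_bigr => i _ do rewrite big_allpairs_dep /=.
have le1 k i l m : (k < j)%N -> (i < n)%N -> (l < j)%N -> (m < n)%N ->
    increment_product V (h, (k, 0%N), (k, i)) (h, (l, 0%N), (l, m)) <=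
    h * h * (c * g k l).
  move=> kj ni lj mn; rewrite /increment_product /= ler_wpM2l ?mulr_ge0//.
  have xL (i' : nat) : (i' < n)%N -> 0 <= i'%:R * h <= L.
    by move=> i'n; rewrite mulr_ge0//= -nh ler_wpM2r// ler_nat ltnW.
  apply: le_trans (ler_wpM2l c_ge0 (cov_le _ _ _ _ kj lj (xL _ ni) (xL _ mn))).
  rewrite le_eqVlt; apply/orP; left; apply/eqP; rewrite /V /tau /= mul0r !addr0.
  rewrite /incr_cov.
  have -> : k%:R * L + i%:R * h - l%:R * L = k%:R * L - l%:R * L + i%:R * h by ring.
  have -> : k%:R * L - (l%:R * L + m%:R * h) = k%:R * L - l%:R * L - m%:R * h by ring.
  have -> : k%:R * L + i%:R * h - (l%:R * L + m%:R * h) =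
    k%:R * L - l%:R * L + i%:R * h - m%:R * h by ring.
  by field.
apply: (@le_trans _ _ (\sum_(0 <= k < j) \sum_(0 <= i < n) \sum_(0 <= l < j)
    \sum_(0 <= m < n) h * h * (c * g k l))).
  apply: ler_sum_nat => k /andP[_ kj]; apply: ler_sum_nat => i /andP[_ ni].
  apply: ler_sum_nat => l /andP[_ lj]; apply: ler_sum_nat => m /andP[_ mn].
  exact: le1.
rewrite le_eqVlt; apply/orP; left; apply/eqP.
rewrite !mulr_sumr; apply: eq_bigr => k _.
rewrite sumr_const_nat subn0 -mulr_natl mulr_sumr mulr_sumr mulr_sumr.
apply: eq_bigr => l _; rewrite sumr_const_nat subn0 -mulr_natl -nh.
by ring.
Qed.

(** The covariances between distinct cells are at most zero; what remains is one
    term [L ^+ 2 * L `^ a] per cell. *)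
Lemma sqint_frozen_riemann_concave (L : R) (n j : nat) : a <= 1 ->
  0 <= L -> (0 < n)%N ->
  (sqint mu (fun w => frozen_riemann (B ^~ w) L n j) <=
    (c * (j%:R * L) * (L * L `^ a))%:E)%E.
Proof.
move=> a1 L0 n0.
apply: le_trans (sqint_frozen_riemann_le L n j
  (fun k l => if k == l then L `^ a else 0) L0 n0 _) _.
  have lt_case (k l : nat) x y : (l < k)%N -> 0 <= x <= L -> 0 <= y <= L ->
      incr_cov a x y (k%:R * L - l%:R * L) <= 0.
    move=> lk x0 y0; apply: (incr_cov_le0 a a_gt0 x y L) => //.
    rewrite -mulrBl -natrB 1?ltnW// ler_peMl// ler1n subn_gt0//.
  move=> k l x y _ _ x0 y0; have [kl|lk|->] := ltngtP k l.
  - by rewrite -opprB incr_covC; exact: lt_case.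
  - exact: lt_case.
  - by rewrite subrr; apply: incr_cov_diag.
rewrite lee_fin -mulrA ler_wpM2l//.
rewrite (eq_big_nat _ _ (F2 := fun=> L `^ a)); last first.
  move=> k /andP[_ kj]; rewrite -big_mkcond /=.
  rewrite (eq_bigl (fun l => l == k)); last by move=> l; rewrite eq_sym.
  by rewrite big_nat1_eq kj.
rewrite sumr_const_nat subn0 -mulr_natl le_eqVlt; apply/orP; left; apply/eqP.
by ring.
Qed.

(** For a fixed cell the covariances with the others telescope to [O(L)], and
    the diagonal term [L `^ a] is [O(L)] as well; there are [T' / L] cells. *)
Lemma sqint_frozen_riemann_convex (T' L : R) (N n j : nat) : 1 <= a ->
  0 < T' -> (0 < n)%N -> (j <= N)%N -> N%:R * L = T' -> 0 <= L ->
  (sqint mu (fun w => frozen_riemann (B ^~ w) L n j) <=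
    (c * (T' `^ a + (2 * T') `^ a) * L ^+ 2)%:E)%E.
Proof.
move=> a1 T0 n0 jN NL L_ge0.
have [j0|N0] := posnP j.
  rewrite (_ : sqint _ _ = 0%E); last first.
    rewrite /sqint integral0_eq// => w _.
    by rewrite /frozen_riemann big_geq ?expr0n// j0.
  by rewrite lee_fin mulr_ge0 ?sqr_ge0// mulr_ge0// addr_ge0// powR_ge0.
have {}N0 : (0 < N)%N by exact: leq_trans jN.
have N0R : 0 < N%:R :> R by rewrite ltr0n.
have L0 : 0 < L by rewrite -(pmulr_rgt0 _ N0R) NL.
have LT : L <= T'.
  by rewrite -NL ler_peMl ?(ltW L0)// ler1n.
pose F (m : nat) := powR_incr a L (m%:R * L) / 2.
pose g k l := if k == l then L `^ a else
  let m := if (l < k)%N then (k - l)%N else (l - k)%N in F m - F m.-1.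
apply: le_trans (sqint_frozen_riemann_le L n j g (ltW L0) n0 _) _.
  have lt_case (k l : nat) x y : (l < k)%N -> 0 <= x <= L -> 0 <= y <= L ->
      incr_cov a x y (k%:R * L - l%:R * L) <= F (k - l)%N - F (k - l).-1.
    move=> lk x0 y0; pose D := k%:R * L - l%:R * L; rewrite -/D /F.
    have -> : (k - l).-1%:R * L = D - L.
      by rewrite -subn1 natrB ?subn_gt0// natrB 1?ltnW// /D; ring.
    have -> : (k - l)%:R * L = D by rewrite natrB 1?ltnW// mulrBl.
    rewrite -mulrBl.
    apply: incr_cov_le => //.
    by rewrite /D -mulrBl -natrB 1?ltnW// ler_peMl ?(ltW L0)// ler1n subn_gt0.
  move=> k l x y _ _ x0 y0; rewrite /g.
  have [kl|lk|->] := ltngtP k l.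
  - by rewrite -opprB incr_covC; exact: lt_case.
  - exact: lt_case.
  - by rewrite subrr; apply: incr_cov_diag.
rewrite lee_fin -mulrA ler_wpM2l// mulrC ler_wpM2r ?sqr_ge0//.
pose K := L / T' * (2 * T') `^ a.
have F_le m : (m <= N)%N -> F m <= K / 2.
  move=> mN; rewrite /F ler_pM2r ?invr_gt0//; apply: powR_incr_le => //.
    by rewrite mulr_ge0 ?(ltW L0)//= -NL ler_wpM2r ?(ltW L0)// ler_nat.
  by rewrite (ltW L0).
have F_ge0 m : 0 <= F m.
  by rewrite /F divr_ge0// powR_incr_ge0 ?mulr_ge0 ?(ltW L0).
apply: (@le_trans _ _ (\sum_(0 <= k < j) (L `^ a + K))).
  apply: ler_sum_nat => k /andP[_ kj].
  rewrite (big_cat_nat (n := k))//= 1?ltnW// (big_ltn kj) /g eqxx.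
  have -> : \sum_(0 <= l < k) (if k == l then L `^ a else
      let m := if (l < k)%N then (k - l)%N else (l - k)%N in F m - F m.-1) =
      F k - F 0%N.
    transitivity (\sum_(0 <= l < k) (- F (k - l.+1)%N - - F (k - l)%N)).
      apply: eq_big_nat => l /andP[_ lk].
      by rewrite gtn_eqF//= lk opprK addrC subnS.
    by rewrite telescope_sumr// subnn subn0 opprK addrC.
  have -> : \sum_(k.+1 <= l < j) (if k == l then L `^ a else
      let m := if (l < k)%N then (k - l)%N else (l - k)%N in F m - F m.-1) =
      F (j - k.+1)%N - F 0%N.
    transitivity (\sum_(k.+1 <= l < j) (F (l.+1 - k.+1)%N - F (l - k.+1)%N)).
      apply: eq_big_nat => l /andP[kl _].
      by rewrite ltn_eqF//= ltnNge (ltnW kl)/= subSS subnS.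
    by rewrite (telescope_sumr (fun l => F (l - k.+1)%N))// subnn.
  have kN : (k <= N)%N by apply: leq_trans jN; exact: ltnW.
  have jkN : (j - k.+1 <= N)%N by apply: leq_trans (leq_subr _ _) jN.
  have := F_le _ kN; have := F_le _ jkN; have := F_ge0 0%N.
  lra.
rewrite sumr_const_nat subn0 -[leLHS]mulr_natl.
apply: (@le_trans _ _ (N%:R * (L `^ a + K))).
  rewrite ler_wpM2r ?ler_nat// addr_ge0 ?powR_ge0// mulr_ge0 ?powR_ge0//.
  by rewrite divr_ge0// ltW.
rewrite mulrDr lerD//; last first.
  by rewrite /K mulrA mulrA NL divff ?mul1r// gt_eqF.
have -> : L `^ a = L * L `^ (a - 1).
  rewrite -[X in X * _]powRr1 ?(ltW L0)// -powRD ?(gt_eqF L0) ?implybT//.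
  by congr powR; ring.
rewrite mulrA NL.
have -> : T' `^ a = T' * T' `^ (a - 1).
  rewrite -[X in X * _]powRr1 ?(ltW T0)// -powRD ?(gt_eqF T0) ?implybT//.
  by congr powR; ring.
rewrite ler_pM2l//.
by apply: ge0_ler_powR; rewrite ?nnegrE ?subr_ge0// ltW.
Qed.

End riemann_second_moment.

(** * Integrals over intervals as limits of Riemann sums *)

Section interval_integrals.
Context {R : realType}.
Local Notation mu := (@lebesgue_measure R).
Implicit Types (f : R -> R) (p q r : R).

Lemma within_integrable f p q : {within `[p, q], continuous f} ->
  mu.-integrable `[p, q] (EFin \o f).
Proof.
by move=> cf; apply: continuous_compact_integrable => //; exact: segment_compact.
Qed.

Lemma integrable_itvS f p q p' q' : mu.-integrable `[p, q] (EFin \o f) ->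
  p <= p' -> q' <= q -> mu.-integrable `[p', q'] (EFin \o f).
Proof.
move=> intf pp qq; apply: integrableS intf => //.
by apply: subset_itv; rewrite bnd_simp.
Qed.

Lemma Rintegral_itv_split f p q r : mu.-integrable `[p, r] (EFin \o f) ->
  p <= q -> q <= r ->
  \int[mu]_(s in `[p, r]) f s =
  \int[mu]_(s in `[p, q]) f s + \int[mu]_(s in `[q, r]) f s.
Proof.
move=> intf pq qr; apply/eqP; rewrite addrC -subr_eq; apply/eqP.
rewrite Rintegral_itvB//= Rintegral_itv_obnd_cbnd//.
apply: integrableS intf => //.
by apply: subset_itv; rewrite bnd_simp.
Qed.

Lemma Rintegral_itv_cst p q (c : R) : p <= q ->
  \int[mu]_(s in `[p, q]) c = c * (q - p).
Proof.
move=> pq; rewrite Rintegral_cst//= lebesgue_measure_itv /= lte_fin.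
by move: pq; rewrite le_eqVlt => /predU1P[->|->//]; rewrite ltxx subrr mulr0.
Qed.

Lemma cst_itv_integrable p q (c : R) : mu.-integrable `[p, q] (EFin \o cst c).
Proof. by apply: within_integrable => x; exact: cvg_cst. Qed.

Lemma itv_integrableB f g p q : mu.-integrable `[p, q] (EFin \o f) ->
  mu.-integrable `[p, q] (EFin \o g) ->
  mu.-integrable `[p, q] (EFin \o (fun s => f s - g s)).
Proof.
move=> intf intg; rewrite (_ : EFin \o _ = (EFin \o f) \- (EFin \o g))%E//.
exact: integrableB.
Qed.

Lemma itv_integrableD f g p q : mu.-integrable `[p, q] (EFin \o f) ->
  mu.-integrable `[p, q] (EFin \o g) ->
  mu.-integrable `[p, q] (EFin \o (fun s => f s + g s)).
Proof.
move=> intf intg; rewrite (_ : EFin \o _ = (EFin \o f) \+ (EFin \o g))%E//.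
exact: integrableD.
Qed.

Lemma itv_integrable_norm f p q : mu.-integrable `[p, q] (EFin \o f) ->
  mu.-integrable `[p, q] (EFin \o (fun s => `|f s|)).
Proof. by move=> intf; exact: (integrable_norm intf). Qed.

Lemma le_normr_Rintegral_itv f p q (e : R) : p <= q ->
  mu.-integrable `[p, q] (EFin \o f) ->
  (forall s, p <= s <= q -> `|f s| <= e) ->
  `|\int[mu]_(s in `[p, q]) f s| <= e * (q - p).
Proof.
move=> pq intf fe; apply: (le_trans (le_normr_Rintegral _ intf)) => //.
rewrite -Rintegral_itv_cst//; apply: le_Rintegral => //.
- exact: (integrable_norm intf).
- exact: cst_itv_integrable.
Qed.

Lemma Rintegral_itv_grid f p (h : R) (n : nat) : 0 <= h ->
  mu.-integrable `[p, p + n%:R * h] (EFin \o f) ->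
  \int[mu]_(s in `[p, p + n%:R * h]) f s =
  \sum_(0 <= i < n) \int[mu]_(s in `[p + i%:R * h, p + i.+1%:R * h]) f s.
Proof.
move=> h0; elim: n => [|n IH] intf.
  by rewrite big_geq// mul0r addr0 set_itv1 Rintegral_set1.
have le1 : p + n%:R * h <= p + n.+1%:R * h.
  by rewrite lerD2l ler_wpM2r// ler_nat.
rewrite (Rintegral_itv_split f p (p + n%:R * h))//; last first.
  by rewrite lerDl mulr_ge0.
by rewrite big_nat_recr//= IH//; exact: integrable_itvS intf _ _.
Qed.

(** Heine's theorem, from the near-covering form of compactness. *)
Lemma within_unif_continuous f p q : {within `[p, q], continuous f} ->
  forall e : R, 0 < e -> exists2 dl : R, 0 < dl &
    forall s r, p <= s <= q -> p <= r <= q -> `|s - r| < dl -> `|f s - f r| < e.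
Proof.
move=> /subspace_continuousP cf e e0.
have /compact_near_coveringP ncov := @segment_compact R p q.
(* The condition [p <= s <= q] is repeated in [close] because near-covering also
   asks about points near the interval but outside it. *)
pose close dl s := p <= s <= q -> forall r, p <= r <= q -> `|s - r| < dl ->
  `|f s - f r| < e.
have : \forall dl \near 0^'+, `[p, q]%classic `<=` close dl.
  apply: ncov => s spq.
  have e2 : 0 < e / 2 by rewrite divr_gt0.
  have /cvgrPdist_lt /(_ _ e2) := cf s spq.
  rewrite /within /= => /nbhs_ballP[d /= d0 near_s].
  have half : 0 < d / 2 by rewrite divr_gt0.
  exists (ball s (d / 2), [set dl | 0 < dl < d / 2]) => /=.
    split; first exact: nbhsx_ballx.
    near=> dl; apply/andP; split; first by near: dl; exact: nbhs_right_gt.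
    by near: dl; exact: nbhs_right_lt.
  move=> [s' dl] /= [+ /andP[_ dl2]] s'pq r rpq s'r.
  rewrite /ball /= => ss'.
  have f1 : `|f s - f s'| < e / 2.
    apply: near_s; last by rewrite /= in_itv.
    by rewrite /ball /=; lra.
  have f2 : `|f s - f r| < e / 2.
    apply: near_s; last by rewrite /= in_itv.
    rewrite /ball /=; have := ler_distD s' s r; lra.
  have := ler_distD (f s) (f s') (f r); rewrite [`|f s' - f s|]distrC; lra.
move=> near_close.
have [dl [dl0 cl]] : exists dl : R, 0 < dl /\ `[p, q]%classic `<=` close dl.
  apply: (@filter_ex _ (0^'+)); near=> dl; split; last by near: dl.
  by near: dl; exact: nbhs_right_gt.
by exists dl => // s r spq rpq; apply: cl => //; rewrite /= in_itv.
Unshelve. all: by end_near.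
Qed.

Lemma riemann_sum_cvg f p q : p <= q -> {within `[p, q], continuous f} ->
  (fun n => \sum_(0 <= i < n.+1)
      (q - p) / n.+1%:R * f (p + i%:R * ((q - p) / n.+1%:R))) @ \oo -->
    \int[mu]_(s in `[p, q]) f s.
Proof.
move=> pq cf; apply/cvgrPdist_le => e e0.
have pq1 : 0 < q - p + 1 by rewrite ltr_wpDl// subr_ge0.
have e1 : 0 < e / (q - p + 1) by rewrite divr_gt0.
have [dl dl0 unif] := within_unif_continuous f p q cf _ e1.
have intf := within_integrable f p q cf.
have d1 : 0 < dl / (q - p + 1) by rewrite divr_gt0.
near=> n; set h := (q - p) / n.+1%:R.
have h0 : 0 <= h by rewrite divr_ge0// subr_ge0.
have nh : n.+1%:R * h = q - p by rewrite mulrC divfK// pnatr_eq0.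
have hdl : h < dl.
  apply: (@le_lt_trans _ _ ((q - p + 1) * n.+1%:R^-1)).
    by rewrite /h ler_wpM2r// lerDl.
  rewrite mulrC -ltr_pdivlMr//.
  near: n; exact: (near_infty_natSinv_lt (PosNum d1)).
have qE : q = p + n.+1%:R * h by rewrite nh; ring.
rewrite {1}qE Rintegral_itv_grid -?qE// -sumrB.
apply: (@le_trans _ _ (\sum_(0 <= i < n.+1) (e / (q - p + 1) * h))); last first.
  rewrite sumr_const_nat subn0 -[leLHS]mulr_natl mulrCA nh.
  by rewrite -mulrA ler_piMr ?(ltW e0)// mulrC ler_pdivrMr// mul1r lerDl.
apply: le_trans (ler_norm_sum _ _ _) _; apply: ler_sum_nat => i /andP[_ ni].
have ih0 : p <= p + i%:R * h by rewrite lerDl mulr_ge0.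
have ihq : p + i.+1%:R * h <= q by rewrite qE lerD2l ler_wpM2r// ler_nat.
have ihi : p + i%:R * h <= p + i.+1%:R * h by rewrite lerD2l ler_wpM2r// ler_nat.
have len : p + i.+1%:R * h - (p + i%:R * h) = h by rewrite -natr1; ring.
have inti := integrable_itvS _ _ _ _ _ intf ih0 ihq.
have -> : h * f (p + i%:R * h) =
    \int[mu]_(s in `[p + i%:R * h, p + i.+1%:R * h]) f (p + i%:R * h).
  by rewrite Rintegral_itv_cst// len mulrC.
rewrite -RintegralB//; last exact: cst_itv_integrable.
rewrite -[X in _ <= _ * X]len; apply: le_normr_Rintegral_itv => //.
  by apply: itv_integrableB => //; exact: cst_itv_integrable.
move=> s /andP[s1 s2]; apply/ltW/unif.
- by rewrite (le_trans ih0 s1) (le_trans s2 ihq).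
- by rewrite ih0 (le_trans ihi ihq).
- rewrite ger0_norm ?subr_ge0//; apply: le_lt_trans hdl.
  by rewrite -[leRHS]len lerD2r.
Unshelve. all: by end_near.
Qed.

End interval_integrals.

(** * Pathwise analysis of the equation and of the scheme *)

Section exp_integral.
Context {R : realType}.
Local Notation mu := (@lebesgue_measure R).

Lemma continuous_expRM (c : R) : continuous (fun s : R => expR (c * s)).
Proof.
move=> s; apply: continuous_comp; last exact: continuous_expR.
exact: mulrl_continuous.
Qed.

Lemma Rintegral_expR_le (t : R) : 0 < t ->
  \int[mu]_(s in `[0, t]) expR (2 * s) <= expR (2 * t) / 2.
Proof.
move=> t0; rewrite /Rintegral.
have dF (s : R) : is_derive s 1 (fun u => 2^-1 * expR (2 * u)) (expR (2 * s)).
  have h : is_derive s (1 : R) (fun u : R => 2 * u) 2.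
    by apply: is_derive_eq; rewrite /GRing.scale /= mulr1.
  have h2 := is_derive1_comp (is_derive_expR (2 * s)) h.
  rewrite (_ : (fun u => _) =
    (fun u => 2^-1 * (expR \o (fun u => 2 * u)) u))//.
  by apply: is_derive_eq; rewrite /GRing.scale /=; field.
have cF : continuous (fun u : R => 2^-1 * expR (2 * u)).
  by move=> s; apply: cvgMr; exact: continuous_expRM.
rewrite (@continuous_FTC2 _ _ (fun s => 2^-1 * expR (2 * s)))//.
- by rewrite -EFinB /= mulr0 expR0; lra.
- by apply: continuous_subspaceT; exact: continuous_expRM.
- split.
  + by move=> s _; have [] := dF s.
  + exact/cvg_at_right_filter/cF.
  + exact/cvg_at_left_filter/cF.
- by move=> s _; rewrite derive1E; have [_ ->] := dF s.
Qed.

End exp_integral.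

Section pathwise_error.
Context {R : realType}.
Local Notation mu := (@lebesgue_measure R).
Variables (T x0 : R) (b x : R -> R).
Hypothesis T_gt0 : 0 < T.
Hypothesis cb : {within `[0, T], continuous b}.
Hypothesis intf : forall t, 0 <= t <= T ->
  mu.-integrable `[0, t] (EFin \o (fun s => - x s + b s)).
Hypothesis solx : forall t, 0 <= t <= T ->
  x t = x0 + \int[mu]_(s in `[0, t]) (- x s + b s).

Let T_ge0 : 0 <= T := ltW T_gt0.

Let drift s := - x s + b s.

Let int_drift : mu.-integrable `[0, T] (EFin \o drift).
Proof. by apply: intf; rewrite T_ge0 lexx. Qed.

Lemma solution_continuous : {within `[0, T], continuous x}.
Proof.
have cF := parameterized_integral_continuous T_ge0 int_drift.
apply: (@subspace_eq_continuous _ _ _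
  (fun t => x0 + parameterized_integral mu 0 t drift)).
  by move=> t; rewrite inE /= in_itv /= => t0T; apply/esym; exact: solx.
by move=> t; apply: cvgD; [exact: cvg_cst|exact: cF].
Qed.

Let cx := solution_continuous.
Let int_b : mu.-integrable `[0, T] (EFin \o b) := within_integrable b 0 T cb.
Let int_x : mu.-integrable `[0, T] (EFin \o x) := within_integrable x 0 T cx.

Let beta := \int[mu]_(s in `[0, T]) `|b s|.

Lemma Rintegral_itv_norm_le f (t : R) : mu.-integrable `[0, T] (EFin \o f) ->
  0 <= t <= T ->
  \int[mu]_(s in `[0, t]) `|f s| <= \int[mu]_(s in `[0, T]) `|f s|.
Proof.
move=> If /andP[t0 tT].
rewrite [leRHS](Rintegral_itv_split _ 0 t)//; last exact: itv_integrable_norm.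
by rewrite lerDl; apply: Rintegral_ge0.
Qed.

(** Gronwall's inequality: the function [expR (- (2 * s)) * `|x s|] attains a
    maximum on the interval, and the integral inequality at the maximizer, where
    the weight halves the integral term, bounds that maximum by [2 * A]. *)
Lemma solution_bound t : 0 <= t <= T ->
  `|x t| <= 2 * expR (2 * T) * (`|x0| + beta).
Proof.
move=> t0T; pose A := `|x0| + beta.
have beta0 : 0 <= beta by apply: Rintegral_ge0.
have A0 : 0 <= A by rewrite addr_ge0.
have gron s : 0 <= s <= T -> `|x s| <= A + \int[mu]_(r in `[0, s]) `|x r|.
  move=> s0T; have /andP[s0 sT] := s0T.
  have Ib := integrable_itvS _ _ _ _ _ int_b (lexx 0) sT.
  have Ix := integrable_itvS _ _ _ _ _ int_x (lexx 0) sT.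
  rewrite solx// (le_trans (ler_normD _ _))// /A -addrA lerD2l.
  apply: (le_trans (le_normr_Rintegral _ (intf _ s0T))) => //.
  apply: (@le_trans _ _ (\int[mu]_(r in `[0, s]) (`|b r| + `|x r|))).
    apply: le_Rintegral => //.
    - exact: (itv_integrable_norm drift _ _ (intf _ s0T)).
    - by apply: itv_integrableD; exact: itv_integrable_norm.
    - by move=> r _; rewrite (le_trans (ler_normD _ _))// normrN addrC.
  rewrite RintegralD//; [|exact: itv_integrable_norm..].
  by rewrite lerD2r; exact: Rintegral_itv_norm_le.
pose u s := expR (- (2 * s)) * `|x s|.
have cu : {within `[0, T], continuous u}.
  move=> s; apply: cvgM.
    apply: continuous_subspaceT => r; rewrite (_ : (fun s => expR _) =
      (fun s : R => expR (- 2 * s))); last by apply/funext => ?; rewrite mulNr.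
    exact: continuous_expRM.
  by apply: cvg_norm; exact: cx.
have [m] := EVT_max T_ge0 cu; rewrite in_itv /= => m0T maxu.
have xu s : 0 <= s <= T -> `|x s| <= u m * expR (2 * s).
  move=> s0T; have := maxu s; rewrite in_itv /= => /(_ s0T).
  move=> /(ler_wpM2r (expR_ge0 (2 * s))); apply: le_trans.
  by rewrite /u mulrAC -expRD addNr expR0 mul1r.
have um0 : 0 <= u m by rewrite mulr_ge0// expR_ge0.
have umE : u m * expR (2 * m) = `|x m| by rewrite /u mulrAC -expRD addNr expR0 mul1r.
have um_le : u m * expR (2 * m) <= 2 * A.
  have [m0 mT] := andP m0T.
  move: m0; rewrite le_eqVlt => /predU1P[m0|m0].
    rewrite umE -m0 solx ?lexx ?T_ge0// set_itv1 Rintegral_set1 addr0.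
    by rewrite /A; have := normr_ge0 x0; lra.
  have Ix := integrable_itvS _ _ _ _ _ int_x (lexx 0) mT.
  have Iexp : mu.-integrable `[0, m] (EFin \o (fun s => expR (2 * s))).
    by apply: within_integrable; apply: continuous_subspaceT; exact: continuous_expRM.
  have Imexp : mu.-integrable `[0, m] (EFin \o (fun s => u m * expR (2 * s))).
    apply: within_integrable; apply: continuous_subspaceT => s.
    by apply: cvgMr; exact: continuous_expRM.
  have := gron m m0T; rewrite -umE.
  have : \int[mu]_(r in `[0, m]) `|x r| <= u m * (expR (2 * m) / 2).
    apply: (@le_trans _ _ (\int[mu]_(r in `[0, m]) (u m * expR (2 * r)))).
      apply: le_Rintegral => //; first exact: itv_integrable_norm.
      move=> s /=; rewrite in_itv /= => /andP[s0 sm].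
      by apply: xu; rewrite s0 (le_trans sm mT).
    rewrite RintegralZl//.
    by rewrite ler_wpM2l// Rintegral_expR_le.
  lra.
apply: le_trans (xu t t0T) _.
have um2 : u m <= 2 * A.
  apply: le_trans um_le; rewrite ler_peMr// -expR0 ler_expR mulr_ge0//.
  by case/andP : m0T.
rewrite -/A [leRHS]mulrAC; apply: ler_pM => //.
by rewrite ler_expR ler_pM2l//; case/andP : t0T.
Qed.

(** From [solution_bound]: the integral of [`|x| + `|b|] over [[0, T]] is at most
    [T * (2 * expR (2 * T)) + 1] times [`|x0| + beta]. *)
Definition drift_const : R := T * (2 * expR (2 * T)) + 1.

Lemma drift_integral_le :
  \int[mu]_(s in `[0, T]) `|drift s| <= drift_const * (`|x0| + beta).
Proof.
apply: (@le_trans _ _ (\int[mu]_(r in `[0, T]) (`|x r| + `|b r|))).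
  apply: le_Rintegral => //.
  - exact: itv_integrable_norm.
  - by apply: itv_integrableD; exact: itv_integrable_norm.
  - by move=> r _; rewrite (le_trans (ler_normD _ _))// normrN.
rewrite RintegralD//; [|exact: itv_integrable_norm..].
rewrite -/beta.
have : `|\int[mu]_(r in `[0, T]) `|x r| | <=
    2 * expR (2 * T) * (`|x0| + beta) * (T - 0).
  apply: le_normr_Rintegral_itv => //; first exact: itv_integrable_norm.
  by move=> s s0T; rewrite normr_id; exact: solution_bound.
rewrite subr0 /drift_const => h.
have := le_trans (ler_norm _) h; have := normr_ge0 x0.
lra.
Qed.

Variables (N : nat) (e : nat -> R).
Hypothesis N_gt0 : (0 < N)%N.

Let L : R := T / N%:R.
Let t (k : nat) : R := k%:R * L.

Hypothesis e0 : e 0%N = x0.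
Hypothesis eS : forall k, e k.+1 = e k + L * (- e k + b (t k)).

Let L_gt0 : 0 < L. Proof. by rewrite divr_gt0// ltr0n. Qed.
Let L_ge0 : 0 <= L := ltW L_gt0.
Let NL : N%:R * L = T.
Proof. by rewrite mulrC divfK// pnatr_eq0 -lt0n. Qed.
Let t_ge0 k : 0 <= t k. Proof. by rewrite mulr_ge0. Qed.
Let t_le k l : (k <= l)%N -> t k <= t l.
Proof. by move=> kl; rewrite ler_wpM2r// ler_nat. Qed.
Let t_leT k : (k <= N)%N -> t k <= T.
Proof. by move=> kN; rewrite -NL; exact: t_le. Qed.
Let tS k : t k.+1 - t k = L.
Proof. by rewrite /t -natr1; ring. Qed.

Let cell f k : R := \int[mu]_(s in `[t k, t k.+1]) f s.

Let int_cell f k : (k < N)%N -> mu.-integrable `[0, T] (EFin \o f) ->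
  mu.-integrable `[t k, t k.+1] (EFin \o f).
Proof. by move=> kN If; apply: integrable_itvS If _ _; rewrite ?t_ge0 ?t_leT. Qed.

Let solution_incr p q : 0 <= p -> p <= q -> q <= T ->
  x q - x p = \int[mu]_(s in `[p, q]) drift s.
Proof.
move=> p0 pq qT.
rewrite !solx ?p0 ?(le_trans p0 pq) ?(le_trans pq qT)//.
rewrite (Rintegral_itv_split drift 0 p q)//; first by ring.
by apply: intf; rewrite (le_trans p0 pq).
Qed.

(* Inside a cell [x] moves by at most the integral of the drift over it. *)
Let sol_cell k : (k < N)%N ->
  `|cell (fun s => x s - x (t k)) k| <= L * cell (fun s => `|drift s|) k.
Proof.
move=> kN; rewrite mulrC -(tS k); apply: le_normr_Rintegral_itv.
- exact: t_le.
- by apply: itv_integrableB; [exact: int_cell|exact: cst_itv_integrable].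
move=> s /andP[ks sk]; have sT := le_trans sk (t_leT _ kN).
rewrite solution_incr//; apply: (le_trans (le_normr_Rintegral _ _)) => //.
  by apply: integrable_itvS int_drift _ _.
rewrite /cell (Rintegral_itv_split (fun s => `|drift s|) (t k) s)//.
  by rewrite lerDl Rintegral_ge0.
by apply: itv_integrable_norm; exact: int_cell.
Qed.

Let error_step k : (k < N)%N ->
  x (t k.+1) - e k.+1 = (x (t k) - e k) - L * (x (t k) - e k)
    - cell (fun s => x s - x (t k)) k + cell (fun s => b s - b (t k)) k.
Proof.
move=> kN; have tk := t_le _ _ (leqnSn k).
have Ix := int_cell x k kN int_x; have Ib := int_cell b k kN int_b.
have : x (t k.+1) - x (t k) = - cell x k + cell b k.
  rewrite solution_incr//; last exact: t_leT.
  rewrite -[RHS]addrC -RintegralB//.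
  by apply: eq_Rintegral => s _; rewrite /drift addrC.
rewrite /cell !RintegralB//; try exact: cst_itv_integrable.
rewrite !Rintegral_itv_cst// tS eS; lra.
Qed.

(** The equation and the scheme are both summed over the cells; freezing [x] and
    [b] at the left end of each cell leaves the two remainders. *)
Lemma path_error_le j : (j <= N)%N ->
  `|x (t j) - e j| <= L * \sum_(0 <= k < j) `|x (t k) - e k| +
    L * (drift_const * (`|x0| + beta)) +
    `|\sum_(0 <= k < j) cell (fun s => b s - b (t k)) k|.
Proof.
move=> jN.
have -> : x (t j) - e j = - (L * \sum_(0 <= k < j) (x (t k) - e k)) -
    \sum_(0 <= k < j) cell (fun s => x s - x (t k)) k +
    \sum_(0 <= k < j) cell (fun s => b s - b (t k)) k.
  rewrite mulr_sumr -sumrN -sumrB -big_split /=.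
  transitivity (\sum_(0 <= k < j) ((x (t k.+1) - e k.+1) - (x (t k) - e k))).
    have xt0 : x (t 0%N) = x0.
      by rewrite /t mul0r solx ?lexx ?T_ge0// set_itv1 Rintegral_set1 addr0.
    by rewrite (telescope_sumr (fun k => x (t k) - e k))// e0 xt0; ring.
  apply: eq_big_nat => k /andP[_ kj]; rewrite error_step; last exact: leq_trans jN.
  by ring.
apply: le_trans (ler_normD _ _) _; rewrite lerD2r.
apply: le_trans (ler_normB _ _) _; apply: lerD.
  by rewrite normrN normrM (gtr0_norm L_gt0) ler_wpM2l// ler_norm_sum.
apply: le_trans (ler_norm_sum _ _ _) _.
apply: (@le_trans _ _ (\sum_(0 <= k < j) L * cell (fun s => `|drift s|) k)).
  by apply: ler_sum_nat => k /andP[_ kj]; apply: sol_cell; exact: leq_trans jN.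
rewrite -mulr_sumr ler_wpM2l//; apply: le_trans drift_integral_le.
apply: le_trans (Rintegral_itv_norm_le drift (t j) int_drift _); last first.
  by rewrite t_ge0 t_leT.
have := Rintegral_itv_grid (fun s => `|drift s|) 0 L j L_ge0.
rewrite add0r => ->.
  rewrite le_eqVlt; apply/orP; left; apply/eqP.
  by apply: eq_bigr => k _; rewrite /cell /t !add0r.
by apply: itv_integrable_norm; apply: integrable_itvS int_drift _ _; rewrite ?t_leT.
Qed.

Lemma frozen_riemann_cvg j : (j <= N)%N ->
  (fun n => frozen_riemann b L n.+1 j) @ \oo -->
  \sum_(0 <= k < j) cell (fun s => b s - b (t k)) k.
Proof.
elim: j => [|k IH] kN.
  by rewrite big_geq// /frozen_riemann; under eq_fun do rewrite big_geq//;
    exact: cvg_cst.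
rewrite big_nat_recr//= /frozen_riemann.
under eq_fun do rewrite big_nat_recr//=.
apply: cvgD; first by apply: IH; exact: ltnW.
have tk := t_le _ _ (leqnSn k).
have sub : `[t k, t k.+1] `<=` `[0, T].
  by apply: subset_itv; rewrite bnd_simp ?t_ge0 ?t_leT.
have cfr : {within `[t k, t k.+1], continuous (fun s => b s - b (t k))}.
  move=> s; apply: cvgB; last exact: cvg_cst.
  exact: (continuous_subspaceW sub cb).
have := riemann_sum_cvg _ _ _ tk cfr.
by rewrite tS.
Qed.

Lemma beta_riemann_cvg :
  (fun n => \sum_(0 <= i < n.+1) T / n.+1%:R * `|b (i%:R * (T / n.+1%:R))|)
    @ \oo --> beta.
Proof.
have cnb : {within `[0, T], continuous (fun s => `|b s|)}.
  by move=> s; apply: cvg_norm; exact: cb.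
have := riemann_sum_cvg _ _ _ T_ge0 cnb; rewrite subr0.
by under eq_fun do under eq_bigr do rewrite add0r.
Qed.

(** The bound of [path_error_le] with its integrals of [b] replaced by Riemann
    sums: evaluated along random paths, it is a measurable function. *)
Definition path_bound (j n : nat) : R :=
  L * \sum_(0 <= k < j) `|x (t k) - e k| +
  L * (drift_const * (`|x0| +
    \sum_(0 <= i < n.+1) T / n.+1%:R * `|b (i%:R * (T / n.+1%:R))|)) +
  `|frozen_riemann b L n.+1 j|.

Lemma path_bound_cvg j : (j <= N)%N ->
  exists2 l, path_bound j @ \oo --> l & `|x (t j) - e j| <= l.
Proof.
move=> jN; eexists; last exact: path_error_le.
apply: cvgD; last by apply: cvg_norm; exact: frozen_riemann_cvg.
apply: cvgD; first exact: cvg_cst.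
apply: cvgMr; apply: cvgMr; apply: cvgD; first exact: cvg_cst.
exact: beta_riemann_cvg.
Qed.

End pathwise_error.

(** * Bounds on means *)

Section mean_bound.
Context {d : measure_display} {Omega : measurableType d} {R : realType}.
Variable P : probability Omega R.
Implicit Types (f g : Omega -> R) (K : R).

Definition mean_bound f K : Prop :=
  [/\ measurable_fun [set: Omega] f, (forall w, 0 <= f w) &
      (\int[P]_w (f w)%:E <= K%:E)%E].

Let mEFin f : measurable_fun [set: Omega] f ->
  measurable_fun [set: Omega] (fun w => (f w)%:E).
Proof. by move=> mf; exact/measurable_EFinP. Qed.

Lemma mean_bound_ge0 f K : mean_bound f K -> 0 <= K.
Proof.
move=> [_ f0 fK]; rewrite -lee_fin; apply: le_trans fK.
by apply: integral_ge0 => w _; rewrite lee_fin.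
Qed.

Lemma mean_boundD f g K K' : mean_bound f K -> mean_bound g K' ->
  mean_bound (fun w => f w + g w) (K + K').
Proof.
move=> [mf f0 fK] [mg g0 gK]; split.
- exact: measurable_funD.
- by move=> w; rewrite addr_ge0.
under eq_integral do rewrite EFinD.
rewrite ge0_integralD//; [|by move=> w _; rewrite lee_fin|exact: mEFin
  |by move=> w _; rewrite lee_fin|exact: mEFin].
by rewrite EFinD; exact: leeD.
Qed.

Lemma mean_boundZ (a : R) f K : 0 <= a -> mean_bound f K ->
  mean_bound (fun w => a * f w) (a * K).
Proof.
move=> a0 [mf f0 fK]; split.
- exact: measurable_funM.
- by move=> w; rewrite mulr_ge0.
under eq_integral do rewrite EFinM.
rewrite ge0_integralZl_EFin//; [|by move=> w _; rewrite lee_fin|exact: mEFin].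
by rewrite EFinM lee_wpmul2l.
Qed.

Lemma mean_bound_sum (f : nat -> Omega -> R) (K : nat -> R) (n : nat) :
  (forall i, (i < n)%N -> mean_bound (f i) (K i)) ->
  mean_bound (fun w => \sum_(0 <= i < n) f i w) (\sum_(0 <= i < n) K i).
Proof.
elim: n => [|n IH] fK.
  rewrite big_geq//.
  rewrite (_ : (fun w => _) = cst 0); last by apply/funext => w; rewrite big_geq.
  by split => //; rewrite integral0.
rewrite big_nat_recr//=.
rewrite (_ : (fun w => _) = (fun w => \sum_(0 <= i < n) f i w + f n w)).
  by apply: mean_boundD; [apply: IH => i ni; apply: fK; exact: ltnW|exact: fK].
by apply/funext => w; rewrite big_nat_recr.
Qed.

Lemma mean_bound_le f K K' : K <= K' -> mean_bound f K -> mean_bound f K'.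
Proof.
by move=> KK [mf f0 fK]; split => //; apply: le_trans fK _; rewrite lee_fin.
Qed.

(** The elementary bound [`|y| <= theta + y ^+ 2 / theta] takes the place of the
    Cauchy--Schwarz inequality. *)
Lemma mean_bound_norm (f : Omega -> R) (theta C : R) : 0 < theta -> 0 <= C ->
  measurable_fun [set: Omega] f -> (sqint P f <= (C * theta ^+ 2)%:E)%E ->
  mean_bound (fun w => `|f w|) ((1 + C) * theta).
Proof.
move=> t0 C0 mf fC; have mnf : measurable_fun [set: Omega] (fun w => `|f w|).
  exact: measurableT_comp.
split => //.
have m1 : mean_bound (fun=> theta) theta.
  split => //; first by move=> _; exact: ltW.
  by rewrite integral_cst//= probability_setT mule1.
have m2 : mean_bound (fun w => f w ^+ 2) (C * theta ^+ 2).
  by split => //; [exact: measurable_funX|move=> w; exact: sqr_ge0].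
have ti0 : 0 <= theta^-1 by rewrite invr_ge0 ltW.
have [m3 _ m4] := mean_boundD _ _ _ _ m1 (mean_boundZ _ _ _ ti0 m2).
apply: (@le_trans _ _ (\int[P]_w (theta + theta^-1 * f w ^+ 2)%:E)%E).
  apply: ge0_le_integral.
  - exact: measurableT.
  - by move=> w _; rewrite lee_fin.
  - exact: mEFin.
  - exact: mEFin.
  - move=> w _; rewrite lee_fin -(ler_pM2l t0) mulrDr mulrA divff ?gt_eqF// mul1r.
    have := sqr_ge0 (theta - `|f w|); have := sqr_ge0 theta.
    rewrite -(real_normK (num_real (f w))); nra.
apply: le_trans m4 _; rewrite lee_fin le_eqVlt; apply/orP; left; apply/eqP.
by field; rewrite gt_eqF.
Qed.

Lemma limn_einf_le (u : nat -> \bar R) (K : \bar R) :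
  (forall n, u n <= K)%E -> (limn_einf u <= K)%E.
Proof.
move=> uK; rewrite limn_einf_lim; apply: lime_le; first exact: is_cvg_einfs.
apply: nearW => n; apply: le_trans (uK n).
by apply: ereal_inf_lbound; exists n => /=.
Qed.

(** Fatou's lemma, in a form that asks nothing of the limit as a function of
    [w]: the time integrals of the paths enter only through this limit. *)
Lemma mean_bound_limit (f : nat -> Omega -> R) (g : Omega -> R) (K : R) :
  (forall n, mean_bound (f n) K) ->
  measurable_fun [set: Omega] g -> (forall w, 0 <= g w) ->
  {ae P, forall w, exists2 l : R, f ^~ w @ \oo --> l & g w <= l} ->
  mean_bound g K.
Proof.
move=> fK mg g0 gf; split => //.
have mf n : measurable_fun [set: Omega] (fun w => (f n w)%:E).
  by apply: mEFin; case: (fK n).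
have f0 n w : [set: Omega] w -> (0 <= (f n w)%:E)%E.
  by move=> _; rewrite lee_fin; case: (fK n).
have := fatou P measurableT mf f0.
move=> /le_trans Hf; apply: le_trans (Hf K%:E _); last first.
  by apply: limn_einf_le => n; case: (fK n).
apply: ae_ge0_le_integral => //.
- by move=> w _; rewrite lee_fin.
- exact: mEFin.
- move=> w _; rewrite limn_einf_lim; apply: lime_ge; first exact: is_cvg_einfs.
  apply: nearW => n; apply: le_ereal_inf_tmp => _ [m _ <-].
  by rewrite lee_fin; case: (fK m).
- apply: measurableT_comp => //; apply: measurable_fun_limn_esup => n.
  exact: measurableT_comp.
apply: filterS gf => w [l fl gl] _.
rewrite (@cvg_limn_einf_sup _ _ l%:E) ?lee_fin//.
by apply: cvg_EFin; [exact: nearW|exact: fl].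
Qed.

End mean_bound.

Section gronwall.
Context {R : realType}.

Lemma geometric_gronwall (L : R) (j : nat) :
  L * \sum_(0 <= k < j) (1 + L) ^+ k + 1 = (1 + L) ^+ j.
Proof.
elim: j => [|j IH]; first by rewrite big_geq// mulr0 add0r expr0.
by rewrite big_nat_recr//= mulrDr addrAC IH exprS; ring.
Qed.

Lemma expr1D_le (T L : R) (N j : nat) : 0 <= L -> N%:R * L = T -> (j <= N)%N ->
  (1 + L) ^+ j <= expR T.
Proof.
move=> L0 NL jN; rewrite -NL expRM_natl.
apply: (@le_trans _ _ ((1 + L) ^+ N)).
  by apply: ler_weXn2l => //; rewrite lerDl.
by apply: lerXn2r; rewrite ?nnegrE ?expR_ge0 ?addr_ge0// expR_ge1Dx.
Qed.

End gronwall.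

(** * Mean error of the Euler scheme *)

Section euler_error.
Context {d : measure_display} {Omega : measurableType d} {R : realType}.
Variables (P : probability Omega R) (T : R).
Variables (B X : R -> {RV P >-> R}) (X0 : {RV P >-> R}).
Hypothesis T_gt0 : 0 < T.
Hypothesis contB :
  {ae P, forall w, {within `[0, +oo[, continuous (fun t => B t w)}}.
Hypothesis solX : pathwise_solution T B X0 X.

Lemma measurable_euler (N j : nat) :
  measurable_fun [set: Omega] (euler T B X0 N j).
Proof.
elim: j => [|j IH] /=; first exact: measurable_funP.
apply: measurable_funD => //; apply: measurable_funM => //.
by apply: measurable_funD => //; exact: measurableT_comp.
Qed.

Lemma measurable_frozen_riemann (L : R) (n j : nat) :
  measurable_fun [set: Omega] (fun w => frozen_riemann (B ^~ w) L n j).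
Proof.
apply: measurable_sum => k; apply: measurable_sum => i.
by apply: measurable_funM => //; exact: measurable_funB.
Qed.

Let drift_const_ge0 : 0 <= drift_const T.
Proof. by rewrite addr_ge0// mulr_ge0 ?(ltW T_gt0)// mulr_ge0// expR_ge0. Qed.

Variables (KB KX : R).
Hypothesis meanB : forall t, 0 <= t <= T -> mean_bound P (fun w => `|B t w|) KB.
Hypothesis meanX0 : mean_bound P (fun w => `|X0 w|) KX.

Variables (N : nat) (theta CS : R).
Hypothesis N_gt0 : (0 < N)%N.
Hypothesis theta_gt0 : 0 < theta.
Hypothesis CS_ge0 : 0 <= CS.
Hypothesis frozenS : forall n j, (j <= N)%N ->
  (sqint P (fun w => frozen_riemann (B ^~ w) (time_step T N) n.+1 j) <=
    (CS * theta ^+ 2)%:E)%E.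

Let L := time_step T N.
Let L_gt0 : 0 < L. Proof. by rewrite divr_gt0// ltr0n. Qed.
Let NL : N%:R * L = T.
Proof. by rewrite mulrC divfK// pnatr_eq0 -lt0n. Qed.

Let K := L * (drift_const T * (KX + T * KB)) + (1 + CS) * theta.

Let mean_path_bound (j n : nat) (u : nat -> R) : (j <= N)%N ->
  (forall k, (k < j)%N ->
     mean_bound P (fun w => `|X (grid T N k) w - euler T B X0 N k w|) (u k)) ->
  mean_bound P (fun w => path_bound T (X0 w) (B ^~ w) (X ^~ w) N
                           (fun k => euler T B X0 N k w) j n)
    (L * \sum_(0 <= k < j) u k + K).
Proof.
move=> jN IH; rewrite /path_bound /K addrA.
apply: mean_boundD; last first.
  apply: mean_bound_norm => //; first exact: measurable_frozen_riemann.
  exact: frozenS.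
apply: mean_boundD.
  apply: mean_boundZ; first exact: ltW.
  exact: mean_bound_sum.
apply: mean_boundZ; first exact: ltW.
apply: mean_boundZ; first exact: drift_const_ge0.
apply: mean_boundD => //.
have n0 : n.+1%:R != 0 :> R by rewrite pnatr_eq0.
rewrite (_ : T * KB = \sum_(0 <= i < n.+1) T / n.+1%:R * KB); last first.
  by rewrite sumr_const_nat subn0 -[RHS]mulr_natl; field.
apply: mean_bound_sum => i ni; apply: mean_boundZ.
  by rewrite divr_ge0// ltW.
have h0 : 0 <= T / n.+1%:R by rewrite divr_ge0// ltW.
apply: meanB; rewrite mulr_ge0//=.
rewrite -[leRHS](_ : n.+1%:R * (T / n.+1%:R) = T); last by field.
by rewrite ler_wpM2r// ler_nat ltnW.
Qed.

(** Discrete Gronwall: the constant [K] collects the terms that do not involve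
    earlier errors, and [K * (1 + L) ^+ j] solves the recursion with equality. *)
Lemma euler_mean_error j : (j <= N)%N ->
  mean_bound P (fun w => `|X (grid T N j) w - euler T B X0 N j w|) (expR T * K).
Proof.
have K0 : 0 <= K.
  have KX0 := mean_bound_ge0 _ _ _ meanX0.
  have KB0 : 0 <= KB.
    by apply: mean_bound_ge0 (meanB 0 _); rewrite lexx ltW.
  rewrite addr_ge0// mulr_ge0// ?(ltW theta_gt0) ?(ltW L_gt0) ?addr_ge0//.
  rewrite mulr_ge0 ?drift_const_ge0// addr_ge0// mulr_ge0//; exact: ltW.
suff err i : (i <= N)%N -> mean_bound P
    (fun w => `|X (grid T N i) w - euler T B X0 N i w|) (K * (1 + L) ^+ i).
  move=> jN; apply: mean_bound_le (err j jN).
  rewrite mulrC ler_wpM2r//.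
  exact: expr1D_le (ltW L_gt0) NL jN.
elim/ltn_ind: i => i IH iN.
apply: (mean_bound_limit P (fun n w => path_bound T (X0 w) (B ^~ w) (X ^~ w) N
                           (fun k => euler T B X0 N k w) i n)).
- move=> n; rewrite -geometric_gronwall mulrDr mulr1 mulrCA mulr_sumr.
  apply: mean_path_bound => // k ki; apply: IH => //.
  by apply: leq_trans iN; exact: ltnW.
- apply: measurableT_comp => //; apply: measurable_funB => //.
  exact: measurable_euler.
- by [].
apply: filterS2 contB solX => w cBw sw.
apply: path_bound_cvg => //.
- by apply: continuous_subspaceW cBw => s /=; rewrite !in_itv /= andbT => /andP[].
- by move=> t t0T; case: (sw t t0T).
- by move=> t t0T; case: (sw t t0T).
Qed.

Lemma max_mean_error_le :
  (max_mean_error T X (euler T B X0) N <= (expR T * K)%:E)%E.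
Proof.
apply: bigmax_le; first exact: leNye.
move=> j _; rewrite unlock.
by have [] := euler_mean_error j (ltn_ord j).
Qed.

End euler_error.

Section euler_order.
Context {d : measure_display} {Omega : measurableType d} {R : realType}.
Variables (P : probability Omega R) (T H : R).
Variables (B X : R -> {RV P >-> R}) (X0 : {RV P >-> R}).
Hypothesis T_gt0 : 0 < T.
Hypothesis H01 : 0 < H < 1.
Hypothesis fbmB : fractional_brownian_motion H B.
Hypothesis X0_L2 : ('E_P[fun w => (`|X0 w| ^+ 2)%R] < +oo)%E.
Hypothesis solX : pathwise_solution T B X0 X.

Let H_gt0 : 0 < H. Proof. by case/andP : H01. Qed.
Let H2_gt0 : 0 < 2 * H. Proof. by rewrite mulr_gt0. Qed.

Let mean_initial : exists KX, mean_bound P (fun w => `|X0 w|) KX.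
Proof.
have sE : sqint P X0 = 'E_P[fun w => (`|X0 w| ^+ 2)%R]%E.
  rewrite unlock; apply: eq_integral => w _.
  by rewrite real_normK ?num_real.
have sfin : sqint P X0 \is a fin_num by rewrite ge0_fin_numE ?sqint_ge0// sE.
exists ((1 + fine (sqint P X0)) * 1); apply: mean_bound_norm => //.
  by rewrite fine_ge0 ?sqint_ge0.
by rewrite expr1n mulr1 fineK.
Qed.

(* The scheme inherits the rate [theta] of the frozen Riemann sums in mean
   square, up to a term of order one. *)
Let euler_rate (theta : nat -> R) (CS : R) : 0 <= CS ->
  (forall N, (0 < N)%N -> 0 < theta N) ->
  (forall N n j, (0 < N)%N -> (j <= N)%N ->
    (sqint P (fun w => frozen_riemann (B ^~ w) (time_step T N) n.+1 j) <=
      (CS * theta N ^+ 2)%:E)%E) ->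
  exists A1 A2 : R, [/\ 0 <= A1, 0 <= A2 & forall N, (0 < N)%N ->
    (max_mean_error T X (euler T B X0) N <=
      (A1 * time_step T N + A2 * theta N)%:E)%E].
Proof.
move=> CS0 th0 frS; have [c c0 varB] := fbm_variance P H B H_gt0 fbmB.
have [KX meanX0] := mean_initial.
have meanB t : 0 <= t <= T ->
    mean_bound P (fun w => `|B t w|) ((1 + c * T `^ (2 * H)) * 1).
  move=> /andP[t0 tT]; apply: mean_bound_norm => //.
    by rewrite mulr_ge0// powR_ge0.
  have [_ ->] := varB t t t0 t0.
  rewrite expr1n mulr1 lee_fin ler_wpM2l// ger0_norm//.
  by apply: (ge0_ler_powR (ltW H2_gt0)); rewrite ?nnegrE// ltW.
have [contB _] := fbmB.
have KX0 := mean_bound_ge0 _ _ _ meanX0.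
have KB0 : 0 <= (1 + c * T `^ (2 * H)) * 1.
  by apply: mean_bound_ge0 (meanB 0 _); rewrite lexx ltW.
exists (expR T * (drift_const T * (KX + T * ((1 + c * T `^ (2 * H)) * 1)))).
exists (expR T * (1 + CS)); split.
- rewrite mulr_ge0 ?expR_ge0// mulr_ge0//.
    by rewrite addr_ge0// mulr_ge0 ?(ltW T_gt0)// mulr_ge0// expR_ge0.
  by rewrite addr_ge0// mulr_ge0// ltW.
- by rewrite mulr_ge0 ?expR_ge0// addr_ge0.
move=> N N0; apply: le_trans (max_mean_error_le P T B X X0 T_gt0 contB solX _ _
  meanB meanX0 N (theta N) CS N0 (th0 N N0) CS0 (fun n j => frS N n j N0)) _.
by rewrite lee_fin le_eqVlt; apply/orP; left; apply/eqP; ring.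
Qed.

Let time_step_gt0 N : (0 < N)%N -> 0 < time_step T N.
Proof. by move=> N0; rewrite divr_gt0// ltr0n. Qed.

Let time_stepM N : (0 < N)%N -> N%:R * time_step T N = T.
Proof. by move=> N0; rewrite mulrC divfK// pnatr_eq0 -lt0n. Qed.

Let varB0 : exists2 c : R, 0 <= c & forall s t, 0 <= s -> 0 <= t ->
  sqint P (fun w => B t w - B s w) = (c * `|t - s| `^ (2 * H))%:E.
Proof.
have [c c0 varB] := fbm_variance P H B H_gt0 fbmB.
by exists c => // s t s0 t0; case: (varB s t s0 t0).
Qed.

Lemma euler_rate_rough : H <= 1 / 2 ->
  exists A1 A2 : R, [/\ 0 <= A1, 0 <= A2 & forall N, (0 < N)%N ->
    (max_mean_error T X (euler T B X0) N <=
      (A1 * time_step T N + A2 * time_step T N `^ (H + 1 / 2))%:E)%E].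
Proof.
move=> Hle; have [c c0 varB] := varB0.
apply: (euler_rate (fun N => time_step T N `^ (H + 1 / 2)) (c * T)).
- by rewrite mulr_ge0// ltW.
- by move=> N N0; rewrite powR_gt0 ?time_step_gt0.
move=> N n j N0 jN; have L0 := time_step_gt0 N N0.
have H2 : 2 * H <= 1 by lra.
apply: le_trans (sqint_frozen_riemann_concave P (fun t => B t : _ -> _) (2 * H) c
  H2_gt0 c0 _ varB (time_step T N) n.+1 j H2 (ltW L0) isT) _ => //.
rewrite lee_fin.
have -> : (time_step T N `^ (H + 1 / 2)) ^+ 2 =
    time_step T N * time_step T N `^ (2 * H).
  rewrite -powR_mulrn ?powR_ge0// -powRrM.
  rewrite -[X in _ = X * _](@powRr1 _ (time_step T N)) ?(ltW L0)//.
  rewrite -powRD ?(gt_eqF L0) ?implybT//.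
  by congr powR; field.
rewrite ler_wpM2r//; first by rewrite mulr_ge0 ?powR_ge0// ltW.
by rewrite ler_wpM2l// -[leRHS](time_stepM N N0) ler_wpM2r ?(ltW L0)// ler_nat.
Qed.

Lemma euler_rate_smooth : 1 / 2 <= H ->
  exists2 A : R, 0 <= A & forall N, (0 < N)%N ->
    (max_mean_error T X (euler T B X0) N <= (A * time_step T N)%:E)%E.
Proof.
move=> Hge; have [c c0 varB] := varB0.
have [||A1 [A2 [A10 A20 le_err]]] := euler_rate (time_step T)
    (c * (T `^ (2 * H) + (2 * T) `^ (2 * H))) _ time_step_gt0.
- by rewrite mulr_ge0// addr_ge0// powR_ge0.
- move=> N n j N0 jN; have H2 : 1 <= 2 * H by lra.
  by apply: (sqint_frozen_riemann_convex P (fun t => B t : _ -> _) (2 * H) c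
    H2_gt0 c0 _ varB T (time_step T N) N n.+1 j H2 T_gt0) => //;
    [exact: time_stepM|exact/ltW/time_step_gt0].
exists (A1 + A2); first by rewrite addr_ge0.
by move=> N N0; rewrite mulrDl; exact: le_err.
Qed.

End euler_order.

Theorem theoremA1 (d : measure_display) (Omega : measurableType d)
    (R : realType) (P : probability Omega R) (T H : R)
    (T_gt0 : 0 < T) (H01 : 0 < H < 1)
    (B : R -> {RV P >-> R}) (fbmB : fractional_brownian_motion H B)
    (X0 : {RV P >-> R})
    (X0_L2 : ('E_P[fun w => (`|X0 w| ^+ 2)%R] < +oo)%E)
    (X : R -> {RV P >-> R}) (solX : pathwise_solution T B X0 X) :
  [/\ H < 1 / 2 -> strong_order T X (euler T B X0) (H + 1 / 2),
      1 / 2 <= H -> strong_order T X (euler T B X0) 1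
    & exists c1 c2 : R, [/\ 0 <= c1, 0 <= c2 &
        forall N : nat, (0 < N)%N ->
          (max_mean_error T X (euler T B X0) N <=
            (c1 * time_step T N + c2 * time_step T N `^ (H + 1 / 2))%:E)%E]].
Proof.
have [H0 H1] := andP H01.
have L0 N : (0 < N)%N -> 0 < time_step T N.
  by move=> N0; rewrite divr_gt0// ltr0n.
have LT N : (0 < N)%N -> time_step T N <= T.
  by move=> N0; rewrite ler_pdivrMr ?ltr0n// ler_peMr ?(ltW T_gt0)// ler1n.
have smooth := euler_rate_smooth P T H B X X0 T_gt0 H01 fbmB X0_L2 solX.
have rough := euler_rate_rough P T H B X X0 T_gt0 H01 fbmB X0_L2 solX.
split.
- move=> Hlt; split; first by rewrite addr_gt0.
  have [A1 [A2 [A10 A20 le_err]]] := rough (ltW Hlt).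
  exists (A1 * T `^ (1 / 2 - H) + A2).
    by rewrite addr_ge0// mulr_ge0// powR_ge0.
  move=> N N0; apply: le_trans (le_err N N0) _.
  rewrite lee_fin mulrDl lerD2r -mulrA ler_wpM2l//.
  have E : time_step T N =
      time_step T N `^ (1 / 2 - H) * time_step T N `^ (H + 1 / 2).
    rewrite -powRD ?(gt_eqF (L0 N N0)) ?implybT//.
    by rewrite (_ : 1 / 2 - H + (H + 1 / 2) = 1) ?powRr1 ?(ltW (L0 N N0))//; field.
  rewrite [leLHS]E.
  rewrite ler_wpM2r ?powR_ge0//; apply: ge0_ler_powR.
  + by rewrite subr_ge0 ltW.
  + by rewrite nnegrE ltW// L0.
  + by rewrite nnegrE ltW.
  + exact: LT.
- move=> Hge; split; first exact: ltr01.
  have [A A0 le_err] := smooth Hge; exists A => // N N0.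
  by rewrite powRr1 ?(ltW (L0 N N0))//; exact: le_err.
- have [Hle|/ltW Hge] := leP H (1 / 2).
    by have [A1 [A2 [? ? le_err]]] := rough Hle; exists A1, A2.
  have [A A0 le_err] := smooth Hge; exists A, 0; split => // N N0.
  by rewrite mul0r addr0; exact: le_err.
Qed.
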